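(* Consider the bottleneck model with a transit outside option, with parameters $\Lambda,\lambda,\mu,e,L,z_C,z_T$ (as described in the context). Suppose $z_T > z_C$ and $\mu<\lambda$. Let $\tau_s^*$ be the static revenue-optimal toll, let $\tau_d^*(\cdot)$ be the dynamic revenue-optimal policy, and let $s = \dfrac{\Lambda e L}{(z_T-z_C)(\lambda-\mu)(e+L)}\ge 0$. Then the ratio of the revenues of the two policies satisfies $$\frac{R(\tau_s^* )}{R(\tau_d^*(\cdot))} \ge \begin{cases} \dfrac{2}{3-\frac{\mu}{\lambda}}, & \text{if } 0\le z_T-z_C < \dfrac{\Lambda e L}{(\lambda-\mu)(e+L)},\\[3mm] \min\left\{\dfrac{2+s}{4},\, \dfrac{1}{2\left(1-\frac{\mu}{\lambda}\right)}\right\}, & \text{if } z_T-z_C\in\left[\dfrac{\Lambda e L}{(\lambda-\mu)(e+L)},\, \dfrac{\Lambda e L}{e+L}\left(\dfrac{1}{\lambda-\mu}+\dfrac{2}{\mu}\right)\right],\\[3mm] \dfrac{2}{3}, & \text{if } z_T-z_C > \dfrac{\Lambda e L}{e+L}\left(\dfrac{1}{\lambda-\mu}+\dfrac{2}{\mu}\right). \end{cases}$$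
   Context: Bottleneck model with outside option. A continuum of users of total mass $\Lambda>0$ has desired bottleneck crossing times $t^*$ uniformly distributed over $[t_1,t_2]$, with desired arrival rate $\lambda = \Lambda/(t_2-t_1)$. Each user travels either by car, through a deterministic first-in-first-out point-queue bottleneck with capacity (maximal service rate) $\mu>0$, or by public transit. All costs are normalized by the value of waiting time. A car user with desired crossing time $t^*$ who crosses the bottleneck at time $t$ pays $$c(t,t^* ) = z_C + w(t) + e\,(t^*-t)_+ + L\,(t-t^* )_+ + \tau(t),$$ where $z_C$ is the free-flow cost of a car trip, $w(t)\ge 0$ is the (endogenous) queuing delay of a vehicle crossing at time $t$ ($w(t)>0$ only when the bottleneck discharges at capacity), $0<e<1$ and $L>0$ are the earliness and lateness penalties, and $\tau(t)\ge 0$ is the toll for crossing at time $t$. A transit user pays the fixed cost $z_T$ and arrives at the desired time. A dynamic tolling policy is a (possibly time-varying) toll function $\tau(\cdot)$; a static toll is a constant one, $\tau(t)=\tau$ for all $t$. Equilibrium: given the toll, every user chooses a mode and, if traveling by car, a crossing time, so as to minimize own cost given $w(\cdot)$, and no user has an incentive to deviate; car users cross in order of their desired crossing times. When users are indifferent between car and transit, ties are broken in favor of higher-revenue outcomes. When $z_T \ge z_C$ and $\mu<\lambda$, car users cross at rate $\mu$ over an equilibrium interval $[t_A,t_D]$ (depending on the policy). Revenue: $R(\tau(\cdot))$ is the total toll paid by car users at the equilibrium induced by the policy; for $z_T\ge z_C$ and $\mu<\lambda$, $R(\tau(\cdot)) = \int_{t_A}^{t_D}\mu\,\tau(t)\,dt$.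 The static (respectively dynamic) revenue-optimal toll maximizes $R$ over all static tolls (respectively all dynamic tolling policies). *)

(* Defs.v *)
From HB Require Import structures.
From mathcomp Require Import all_boot all_order all_algebra.
From mathcomp Require Import all_classical all_reals all_analysis.

Set Implicit Arguments.
Unset Strict Implicit.
Unset Printing Implicit Defensive.

Import Order.TTheory GRing.Theory Num.Theory.
Import numFieldNormedType.Exports.

Local Open Scope classical_set_scope.
Local Open Scope ring_scope.

(* All costs are expressed in units of waiting time. *)
Record bottleneck (R : realType) := Bottleneck {
  total_mass : R;
  desired_first : R;
  desired_last : R;
  capacity : R;
  earliness : R;
  lateness : R;
  car_cost : R;
  transit_cost : R;
  total_mass_gt0 : 0 < total_mass;
  desired_first_lt_last : desired_first < desired_last;
  capacity_gt0 : 0 < capacity;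
  earliness_gt0 : 0 < earliness;
  earliness_lt1 : earliness < 1;
  lateness_gt0 : 0 < lateness }.

Definition desired_rate (R : realType) (M : bottleneck R) : R :=
  total_mass M / (desired_last M - desired_first M).

(* Cost of crossing at [t] for a car user who would like to cross at [v], under
   the toll [tau] and the queuing delay [w]. *)
Definition trip_cost (R : realType) (M : bottleneck R) (tau w : R -> R)
    (t v : R) : R :=
  car_cost M + w t + earliness M * Num.max (v - t) 0
    + lateness M * Num.max (t - v) 0 + tau t.

(* [crossing_rate t]: rate at which cars cross the bottleneck at time [t];
   [crosser t]: desired time of the users crossing at [t], meaningful only
     where [crossing_rate t > 0];
   [car_density v]: density of car users among the users with desired time [v],
     whose total density is [desired_rate]; the others use transit;
   [delay t]: queuing delay of a vehicle crossing at [t]. *)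
Record outcome (R : realType) := Outcome {
  crossing_rate : R -> R;
  crosser : R -> R;
  car_density : R -> R;
  delay : R -> R }.

(* Flow conditions, independent of the users' choices.  The FIFO condition says
   that the time [t - delay t] of joining the queue is nondecreasing in the
   crossing time.  With [feasible_queue] it yields the point-queue dynamics:
   the bottleneck discharges at capacity all along ]t - delay t, t[, so that
   [delay t] is the queue found on joining, divided by the capacity. *)
Record feasible (R : realType) (M : bottleneck R) (X : outcome R) : Prop := {
  feasible_rate_measurable : measurable_fun setT (crossing_rate X);
  feasible_rate : forall t, 0 <= crossing_rate X t <= capacity M;
  feasible_density_measurable : measurable_fun setT (car_density X);
  feasible_density : forall v, desired_first M <= v <= desired_last M ->
    0 <= car_density X v <= desired_rate M;
  feasible_crosser : forall t, 0 < crossing_rate X t ->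
    desired_first M <= crosser X t <= desired_last M;
  (* The cars crossing the bottleneck are those of the car users: for every [u],
     as many cars cross with desired time at most [u] as there are car users
     with desired time at most [u]. *)
  feasible_mass : forall u,
    (\int[lebesgue_measure]_(t in [set t | 0 < crossing_rate X t /\
                                           crosser X t <= u]%R)
        (crossing_rate X t)%:E
     = \int[lebesgue_measure]_(v in `[desired_first M,
                                      Num.min u (desired_last M)])
        (car_density X v)%:E)%E;
  feasible_order : forall s t, 0 < crossing_rate X s -> 0 < crossing_rate X t ->
    s <= t -> crosser X s <= crosser X t;
  feasible_delay : forall t, 0 <= delay X t;
  feasible_queue : forall t, 0 < delay X t -> crossing_rate X t = capacity M;
  feasible_fifo : forall s t, s <= t -> s - delay X s <= t - delay X t }.

(* No user gains by changing mode or crossing time, given the delays.  Car users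
   of desired time [v] are present in the crossing flow; transit users of
   desired time [v] exist when [car_density X v < desired_rate M]. *)
Record equilibrium (R : realType) (M : bottleneck R) (tau : R -> R)
    (X : outcome R) : Prop := {
  equilibrium_feasible : feasible M X;
  equilibrium_car_time : forall t, 0 < crossing_rate X t -> forall s,
    trip_cost M tau (delay X) t (crosser X t)
      <= trip_cost M tau (delay X) s (crosser X t);
  equilibrium_car_mode : forall t, 0 < crossing_rate X t ->
    trip_cost M tau (delay X) t (crosser X t) <= transit_cost M;
  equilibrium_transit : forall v, desired_first M <= v <= desired_last M ->
    car_density X v < desired_rate M -> forall s,
    transit_cost M <= trip_cost M tau (delay X) s v }.

Definition toll_paid (R : realType) (tau : R -> R) (X : outcome R) : R :=
  \int[lebesgue_measure]_t (crossing_rate X t * tau t).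

(* Ties are broken in favour of revenue, hence the supremum over the equilibria
   induced by [tau].  A car user pays at most [transit_cost M - car_cost M], so
   the set is bounded above; a policy without equilibrium earns [sup set0 = 0]. *)
Definition revenue (R : realType) (M : bottleneck R) (tau : R -> R) : R :=
  sup [set toll_paid tau X | X in [set X | equilibrium M tau X]].

Definition toll_policy (R : realType) (tau : R -> R) : Prop :=
  measurable_fun setT tau /\ forall t, 0 <= tau t.

Definition static_optimal (R : realType) (M : bottleneck R) (tau : R) : Prop :=
  0 <= tau /\
  forall tau', 0 <= tau' -> revenue M (fun=> tau') <= revenue M (fun=> tau).

Definition dynamic_optimal (R : realType) (M : bottleneck R) (tau : R -> R) :
    Prop :=
  toll_policy tau /\
  forall tau', toll_policy tau' -> revenue M tau' <= revenue M tau.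

(* Main.v *)
(* Write D for the transit cost minus the car cost, T for the length of the
   desired interval, q = 1 - mu / lambda and K = 1 / e + 1 / L.

   Upper bound.  In any equilibrium let C(v) be the least trip cost of a user with
   desired time v.  Since lambda > mu, the users who strictly prefer the car
   cannot all cross near their desired times, and this forces C to have slope e
   up to the last early crosser b, and slope -L from the first late crosser a on,
   with b <= a.  Hence the toll is at most D - e (b - t) before b,
   D - L (t - a) after a and D in between, while at most lambda (b - t1) and
   lambda (t2 - a) cars cross before b and after a.  This gives, for 0 <= c <= D,
   a revenue of at most T max(lambda (D - c), mu D) + mu c^2 K / 2.

   Lower bound.  For d <= min(D, Lambda / (mu K)) the static toll D - d has an
   equilibrium in which the car rush lasts T + q d K.

   The three cases take d = 0, d = (D - lo) / 2 and d = Lambda / (mu K) for the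
   lower bound, and c = q D, c = q D and c = Lambda / (mu K) for the upper one. *)
Require Import Defs.
From HB Require Import structures.
From mathcomp Require Import all_boot all_order all_algebra.
From mathcomp Require Import all_classical all_reals all_analysis.
From mathcomp Require Import measurable_realfun ring lra.

Set Implicit Arguments.
Unset Strict Implicit.
Unset Printing Implicit Defensive.

Import Order.TTheory GRing.Theory Num.Theory.
Import numFieldNormedType.Exports.

Local Open Scope classical_set_scope.
Local Open Scope ring_scope.

(** * Schedule penalties and the slope of the least trip cost *)

Definition schedule_cost (R : realType) (e L t v : R) : R :=
  e * Num.max (v - t) 0 + L * Num.max (t - v) 0.

Lemma schedule_cost_early (R : realType) (e L t v : R) :
  t <= v -> schedule_cost e L t v = e * (v - t).
Proof.
by move=> tv; rewrite /schedule_cost max_l ?max_r ?mulr0 ?addr0; lra.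
Qed.

Lemma schedule_cost_late (R : realType) (e L t v : R) :
  v <= t -> schedule_cost e L t v = L * (t - v).
Proof.
by move=> tv; rewrite /schedule_cost max_r ?max_l ?mulr0 ?add0r; lra.
Qed.

(** Time reversal exchanges earliness and lateness; this turns the early slope argument into the
    late one. *)
Lemma schedule_cost_opp (R : realType) (e L t v : R) :
  schedule_cost L e (- t) (- v) = schedule_cost e L t v.
Proof. by rewrite /schedule_cost addrC !opprK ![- _ + _]addrC. Qed.

Lemma schedule_cost_ge0 (R : realType) (e L t v : R) :
  0 <= e -> 0 <= L -> 0 <= schedule_cost e L t v.
Proof. by move=> e0 L0; rewrite addr_ge0// mulr_ge0// le_max lexx orbT. Qed.

(** Subadditivity of the positive part. The penalty is thus an asymmetric distance, and least costs
    will be 1-Lipschitz for it. *)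
Lemma schedule_cost_triangle (R : realType) (e L s u v : R) :
  0 <= e -> 0 <= L ->
  schedule_cost e L s v <= schedule_cost e L s u + schedule_cost e L u v.
Proof.
move=> e0 L0; rewrite /schedule_cost.
have H (a b : R) : Num.max (a + b) 0 <= Num.max a 0 + Num.max b 0.
  by rewrite ge_max lerD ?addr_ge0// le_max lexx ?orbT.
rewrite addrACA -!mulrDr lerD// ler_wpM2l//.
  by rewrite (_ : v - s = (u - s) + (v - u)); [exact: H|ring].
by rewrite (_ : s - v = (s - u) + (u - v)); [exact: H|ring].
Qed.

(* [cross t x] stands for "a user with desired time x crosses at t".  Let a be
   the first point from which C has slope e up to x: users desired in ]a, x[ can
   cross neither before a (a would not be first) nor after x (C would decrease
   there), which contradicts the counting hypothesis unless a <= v. *)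
Lemma early_slope (R : realType) (e L lo hi Z : R) (C : R -> R)
    (cross : R -> R -> Prop) :
  0 < e -> 0 < L ->
  (forall u v, C v <= C u + schedule_cost e L u v) ->
  (forall t x, cross t x -> C x = C t + schedule_cost e L t x) ->
  (forall t x, cross t x -> C x <= Z) ->
  (forall t x, cross t x -> lo <= x <= hi) ->
  (forall a b, lo <= a -> a < b -> b <= hi ->
    (forall v, a < v < b -> C v < Z) ->
    exists t x, [/\ cross t x, a < x < b & t < a \/ b < t]) ->
  forall t x v, cross t x -> t < x -> lo <= v <= x -> C x = C v + e * (x - v).
Proof.
move=> e0 L0 Clip crossC crossZ crossI count t x v ctx tx /andP[lov vx].
have Cinc u w : u <= w -> C w <= C u + e * (w - u).
  by move=> uw; rewrite -(schedule_cost_early e L uw).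
have Cdec u w : u <= w -> C u <= C w + L * (w - u).
  by move=> uw; rewrite -(schedule_cost_late e L uw).
pose S : set R := [set y | v <= y <= x /\ C x = C y + e * (x - y)]%classic.
have Sx : S x by split; [rewrite vx lexx|rewrite subrr mulr0 addr0].
have Slb : lbound S v by move=> y [/andP[]].
have hS : has_inf S by split; [exists x|exists v].
pose a := inf S.
have aS y : S y -> a <= y by apply: ge_inf; exists v.
have va : v <= a by apply: lb_le_inf => //; exists x.
have ax : a <= x by apply: aS.
(* The infimum is attained: [C] falls at rate at most [L], so replacing [a] by a point of [S] closer
   than [d / (e + L)] changes the identity by at most [d]. *)
have Sa : C x = C a + e * (x - a).
  apply/eqP; rewrite eq_le Cinc//=; apply/ler_addgt0Pr => d d0.
  have dp : 0 < d / (e + L) by rewrite divr_gt0// addr_gt0.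
  have [y Sy ya] := inf_adherent dp hS.
  have := Cdec _ _ (aS _ Sy).
  have [_ ->] := Sy.
  rewrite -/a -ltrBlDl ltr_pdivlMr ?addr_gt0// in ya; lra.
move: va; rewrite le_eqVlt => /orP[/eqP-> //|va].
have Sgt y : v <= y -> y < a -> C x <> C y + e * (x - y).
  move=> vy ya H; have : S y by split => //; rewrite vy (le_trans (ltW ya)).
  by move=> /aS; rewrite leNgt ya.
(* A crossing at [t' < a] by a user desired in []a, x]] makes [C] rise at slope [e] from [t'] up to
   [x]; then [t'], or [v] if [t' <= v], would precede [a] in [S]. *)
have cover t' x' : cross t' x' -> a < x' <= x -> t' < a -> False.
  move=> c' /andP[ax' x'x] t'a.
  have t'x' : t' <= x' by lra.
  have E := crossC _ _ c'; rewrite schedule_cost_early// in E.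
  have := Cinc _ _ (ltW ax'); have := Cinc _ _ x'x => H1 H2.
  have [tv|vt] := leP t' v.
    apply: (@Sgt v) => //.
    have := Cinc _ _ tv; have : v <= x' by lra.
    move=> /Cinc H3 H4; lra.
  apply: (@Sgt t') => //; first exact: ltW.
  lra.
(* The given early crossing at [t] already provides a stretch of slope [e] ending at [x], so [S] is
   not reduced to [x]. *)
have xa : a < x.
  rewrite lt_neqAle ax andbT; apply/eqP => axE.
  have [tv|vt] := leP t v.
    have E := crossC _ _ ctx; rewrite schedule_cost_early ?(ltW tx)// in E.
    apply: (@Sgt v) => //.
    have := Cinc _ _ tv; have := Cinc _ _ vx; lra.
  apply: (@Sgt t); [exact: ltW|lra|].
  by rewrite -(schedule_cost_early e L (ltW tx)); exact: crossC.
have /andP[_ xhi] := crossI _ _ ctx.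
have Cin u : a < u < x -> C u = C x - e * (x - u).
  move=> /andP[au ux]; have := Cinc _ _ (ltW au); have := Cinc _ _ (ltW ux); lra.
have [||t' [x' [c' /andP[ax' x'x] [t'a|xt']]]] := count a x _ xa xhi.
- lra.
- move=> u au; rewrite Cin//; have := crossZ _ _ ctx.
  have : 0 < e * (x - u) by apply: mulr_gt0 => //; lra.
  lra.
- by exfalso; apply: (cover t' x') => //; lra.
(* A late crossing beyond [x] forces [C] to decrease from [x'] to [x], whereas [C] has slope [e > 0]
   there. *)
- have E := crossC _ _ c'; rewrite schedule_cost_late in E; last by lra.
  have := Cdec _ _ (ltW xt').
  have := Cin _ (introT andP (conj ax' x'x)).
  have : 0 < e * (x - x') by apply: mulr_gt0 => //; lra.
  have : 0 < L * (x - x') by apply: mulr_gt0 => //; lra.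
  lra.
Qed.

(** Mirror image: [early_slope] for [C] composed with negation, the two penalties being
    exchanged. *)
Lemma late_slope (R : realType) (e L lo hi Z : R) (C : R -> R)
    (cross : R -> R -> Prop) :
  0 < e -> 0 < L ->
  (forall u v, C v <= C u + schedule_cost e L u v) ->
  (forall t x, cross t x -> C x = C t + schedule_cost e L t x) ->
  (forall t x, cross t x -> C x <= Z) ->
  (forall t x, cross t x -> lo <= x <= hi) ->
  (forall a b, lo <= a -> a < b -> b <= hi ->
    (forall v, a < v < b -> C v < Z) ->
    exists t x, [/\ cross t x, a < x < b & t < a \/ b < t]) ->
  forall t x v, cross t x -> x < t -> x <= v <= hi -> C x = C v + L * (v - x).
Proof.
move=> e0 L0 Clip crossC crossZ crossI count t x v ctx xt /andP[xv vhi].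
have := @early_slope R L e (- hi) (- lo) Z (C \o -%R)
  (fun t x => cross (- t) (- x)) L0 e0 _ _ _ _ _ (- t) (- x) (- v).
rewrite /= !opprK [- x + v]addrC; apply => //.
- by move=> u w; rewrite -schedule_cost_opp; exact: Clip.
- move=> u w /crossC ->; rewrite -[in RHS]schedule_cost_opp //.
- by move=> u w /crossZ.
- by move=> u w /crossI; lra.
- move=> a b lea ab bhi H.
  have [||| |t' [x' [c' x'ab t'ab]]] := count (- b) (- a); [lra|lra|lra| |].
    by move=> w wab; rewrite -[w]opprK; apply: H; lra.
  exists (- t'), (- x'); rewrite !opprK; split => //; [lra|].
  by case: t'ab => ?; [right|left]; lra.
- lra.
- lra.
Qed.

(** * Integrals of affine bounds *)

Lemma integral_affine (R : realType) (k m x y : R) : x <= y ->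
  (\int[lebesgue_measure]_(t in `[x, y]) (k * t + m)%:E
   = (k * (y ^+ 2 - x ^+ 2) / 2 + m * (y - x))%:E)%E.
Proof.
rewrite le_eqVlt => /orP[/eqP <-|xy].
  by rewrite set_itv1 integral_set1 !subrr !mulr0 mul0r addr0.
pose F : R -> R := (k / 2) \*: (@id R) ^+ 2 + m \*: (@id R).
have FE t : F t = k / 2 * t ^+ 2 + m * t by [].
have dF t : is_derive t (1 : R) F (k * t + m).
  have dF1 := @is_deriveZ _ _ _ _ (k / 2) t 1 _
    (@is_deriveX _ _ id 2 t 1 1 (is_derive_id t 1)).
  have dF2 := @is_deriveZ _ _ _ id m t 1 1 (is_derive_id t 1).
  have E : k / 2 * (2 * t ^+ 1 * 1) + m * 1 = k * t + m.
    by rewrite !mulr1 expr1; field.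
  by rewrite -E; exact: is_deriveD dF1 dF2.
have cF t : {for t, continuous F}.
  apply: differentiable_continuous; apply/derivable1_diffP.
  by have [] := dF t.
rewrite (@continuous_FTC2 R _ F)//.
- by rewrite -EFinB !FE; congr _%:E; field.
- apply: continuous_subspaceT => t.
  by apply: cvgD; [apply: cvgM; [exact: cvg_cst|exact: cvg_id]|exact: cvg_cst].
- split=> [t _||]; first by have [] := dF t.
    exact: cvg_at_right_filter (cF _).
  exact: cvg_at_left_filter (cF _).
- by move=> t _; rewrite derive1E derive_val.
Qed.

Lemma measurable_affine (R : realType) (D : set R) (k m : R) :
  measurable_fun D (fun t => (k * t + m)%:E).
Proof. by apply/measurable_EFinP; exact: measurable_funD. Qed.

Lemma measurable_mulEFin (R : realType) (D : set R) (f g : R -> R) :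
  measurable_fun setT f -> measurable_fun setT g ->
  measurable_fun D (fun t => (f t * g t)%:E).
Proof.
move=> mf mg; apply/measurable_EFinP; apply: measurable_funS (measurableT) _ _ => //.
exact: measurable_funM.
Qed.

(* Splitting [tau <= A + (k t + m)] bounds the revenue by a part proportional to
   the mass of cars plus [mu] times the area of the triangle where k t + m >= 0;
   optimizing over [A] replaces a rearrangement argument. *)
Lemma wing_revenue (R : realType) (mu A k m x y : R) (S : set R)
    (rate tau : R -> R) :
  measurable S -> measurable_fun setT rate -> measurable_fun setT tau ->
  (forall t, 0 <= rate t <= mu) -> (forall t, 0 <= tau t) ->
  0 <= A -> x <= y ->
  (forall t, x <= t <= y -> 0 <= k * t + m) ->
  (forall t, S t -> ~ (x <= t <= y) -> k * t + m <= 0) ->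
  (forall t, S t -> 0 < rate t -> tau t <= A + (k * t + m)) ->
  (\int[lebesgue_measure]_(t in S) (rate t * tau t)%:E
   <= A%:E * \int[lebesgue_measure]_(t in S) (rate t)%:E
      + (mu * (k * (y ^+ 2 - x ^+ 2) / 2 + m * (y - x)))%:E)%E.
Proof.
move=> mS mrate mtau rateP tau0 A0 xy kin kout tauP.
(* By the two sign hypotheses, [g] coincides on [S] with the positive part of [k * t + m]. *)
pose g t : \bar R := ((fun t => (k * t + m)%:E) \_ `[x, y])%classic t.
have gE t : g t = (if x <= t <= y then k * t + m else 0)%:E.
  by rewrite /g patchE mem_setE in_itv/=; case: ifP.
have mu0 : 0 <= mu by have /andP[] := rateP 0; exact: le_trans.
have maff D := @measurable_affine R D k m.
have mg D : measurable D -> measurable_fun D g.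
  move=> mD; apply: measurable_funS (measurableT) _ _ => //.
  by apply/(measurable_restrictT _ _).1 => //; exact: measurable_itv.
have g0 t : (0 <= g t)%E.
  by rewrite gE lee_fin; case: ifP => // /kin.
have mrS : measurable_fun S (fun t => (rate t)%:E).
  by apply/measurable_EFinP; apply: measurable_funS mrate.
have r0 t : 0 <= rate t by have /andP[] := rateP t.
apply: (@le_trans _ _ (\int[lebesgue_measure]_(t in S)
    (A%:E * (rate t)%:E + mu%:E * g t))%E).
  apply: ge0_le_integral => //.
  - by move=> t _; rewrite lee_fin mulr_ge0.
  - exact: measurable_mulEFin.
  - by apply: emeasurable_funD; apply: emeasurable_funM => //; exact: mg.
  - move=> t St; rewrite gE -!EFinM -EFinD lee_fin.
    have [rt|] := ltP 0 (rate t); last first.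
      move=> rt; have -> : rate t = 0 by apply/eqP; rewrite eq_le rt r0.
      rewrite mul0r mulr0 add0r mulr_ge0//; case: ifP => // /kin //.
    apply: (@le_trans _ _ (rate t * (A + (k * t + m)))).
      by rewrite ler_wpM2l// tauP.
    rewrite mulrDr [rate t * A]mulrC lerD2l.
    case: ifPn => [/kin kt|/negP /(kout _ St) kt].
      by rewrite ler_wpM2r//; have /andP[] := rateP t.
    by rewrite mulr0 mulr_ge0_le0.
rewrite ge0_integralD//; last 4 first.
- by move=> t _; rewrite mule_ge0// lee_fin.
- by apply: emeasurable_funM.
- by move=> t _; rewrite mule_ge0.
- by apply: emeasurable_funM => //; exact: mg.
rewrite ge0_integralZl_EFin//; last by move=> t _; rewrite lee_fin.
rewrite ge0_integralZl_EFin//; last exact: mg.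
rewrite leeD2l// EFinM lee_wpmul2l ?lee_fin//.
rewrite -integral_affine//.
apply: (@le_trans _ _ (\int[lebesgue_measure]_t g t)%E).
  by apply: ge0_subset_integral => //; exact: mg.
by rewrite [leRHS]integral_mkcond.
Qed.

(** * Least trip cost in an equilibrium *)

(** The function [C(v)] of the upper bound argument. It is an infimum because an arbitrary toll need
    not admit a cheapest crossing time. *)
Definition user_cost (R : realType) (M : bottleneck R) (tau w : R -> R)
    (v : R) : R :=
  inf (range (fun t => trip_cost M tau w t v)).

Lemma trip_costE (R : realType) (M : bottleneck R) (tau w : R -> R) (t v : R) :
  trip_cost M tau w t v
  = car_cost M + w t + tau t + schedule_cost (earliness M) (lateness M) t v.
Proof. by rewrite /trip_cost /schedule_cost; ring. Qed.

Lemma user_cost_ge (R : realType) (M : bottleneck R) (tau w : R -> R)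
    (v z : R) :
  (forall t, z <= trip_cost M tau w t v) -> z <= user_cost M tau w v.
Proof.
move=> H; apply: lb_le_inf; first by exists (trip_cost M tau w 0 v), 0.
by move=> _ [t _ <-].
Qed.

Lemma user_cost_le (R : realType) (M : bottleneck R) (tau w : R -> R)
    (t v : R) :
  (forall t, 0 <= tau t) -> (forall t, 0 <= w t) ->
  user_cost M tau w v <= trip_cost M tau w t v.
Proof.
move=> tau0 w0; apply: ge_inf; last by exists t.
exists (car_cost M) => _ [s _ <-].
rewrite trip_costE; have := tau0 s; have := w0 s.
have := schedule_cost_ge0 s v (ltW (earliness_gt0 M)) (ltW (lateness_gt0 M)).
lra.
Qed.

(** Whatever crossing time suits a user desired at [u] is open to one desired at [v], for an extra
    penalty bounded by the triangle inequality. *)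
Lemma user_cost_lip (R : realType) (M : bottleneck R) (tau w : R -> R)
    (u v : R) :
  (forall t, 0 <= tau t) -> (forall t, 0 <= w t) ->
  user_cost M tau w v
  <= user_cost M tau w u + schedule_cost (earliness M) (lateness M) u v.
Proof.
move=> tau0 w0; rewrite -lerBlDr; apply: user_cost_ge => t; rewrite lerBlDr.
apply: le_trans (user_cost_le M t v tau0 w0) _.
have := schedule_cost_triangle t u v (ltW (earliness_gt0 M))
  (ltW (lateness_gt0 M)).
by rewrite !trip_costE; lra.
Qed.

(** The Lipschitz bound is tight between a crossing time and its user: a user desired exactly at [t]
    could cross at [t] free of penalty, paying only the delay and toll that the actual crosser finds
    optimal. *)
Lemma user_cost_crosser (R : realType) (M : bottleneck R) (tau : R -> R)
    (X : outcome R) (t : R) :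
  (forall t, 0 <= tau t) -> equilibrium M tau X -> 0 < crossing_rate X t ->
  user_cost M tau (delay X) (crosser X t)
  = user_cost M tau (delay X) t
    + schedule_cost (earliness M) (lateness M) t (crosser X t).
Proof.
move=> tau0 [fX carX _ _] rt; have w0 := feasible_delay fX.
apply/eqP; rewrite eq_le user_cost_lip//=.
apply: (@le_trans _ _ (trip_cost M tau (delay X) t (crosser X t))).
  rewrite trip_costE lerD2r; apply: le_trans (user_cost_le M t t tau0 w0) _.
  by rewrite trip_costE schedule_cost_early// subrr mulr0 addr0.
by apply: user_cost_ge => s; exact: carX.
Qed.

(** By tightness the penalty of the crosser cancels, so the car cost, delay and toll at [t] add up
    to at most the least cost at [t]; the delay is nonnegative. *)
Lemma toll_le_user_cost (R : realType) (M : bottleneck R) (tau : R -> R)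
    (X : outcome R) (t : R) :
  (forall t, 0 <= tau t) -> equilibrium M tau X -> 0 < crossing_rate X t ->
  tau t <= user_cost M tau (delay X) t - car_cost M.
Proof.
move=> tau0 eX rt; have := user_cost_crosser tau0 eX rt.
case: eX => fX carX _ _; have w0 := feasible_delay fX.
have : trip_cost M tau (delay X) t (crosser X t) <=
    user_cost M tau (delay X) (crosser X t).
  by apply: user_cost_ge => s; exact: carX.
by rewrite trip_costE; have := w0 t; lra.
Qed.

Lemma user_cost_crosser_le (R : realType) (M : bottleneck R) (tau : R -> R)
    (X : outcome R) (t : R) :
  (forall t, 0 <= tau t) -> equilibrium M tau X -> 0 < crossing_rate X t ->
  user_cost M tau (delay X) (crosser X t) <= transit_cost M.
Proof.
move=> tau0 [fX _ modeX _] rt; have w0 := feasible_delay fX.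
by apply: le_trans (modeX _ rt); exact: user_cost_le.
Qed.

Lemma full_car_density (R : realType) (M : bottleneck R) (tau : R -> R)
    (X : outcome R) (v : R) :
  equilibrium M tau X -> desired_first M <= v <= desired_last M ->
  user_cost M tau (delay X) v < transit_cost M ->
  car_density X v = desired_rate M.
Proof.
move=> [fX _ _ transX] vI Cv; apply/eqP; rewrite eq_le.
have /andP[_ ->] /= := feasible_density fX vI.
rewrite leNgt; apply/negP => /(transX _ vI) H.
by move: Cv; rewrite ltNge user_cost_ge.
Qed.

(** * Counting cars by crossing time and by desired time *)

Lemma desired_rateM (R : realType) (M : bottleneck R) :
  desired_rate M * (desired_last M - desired_first M) = total_mass M.
Proof.
by rewrite /desired_rate mulfVK// subr_eq0 gt_eqF// desired_first_lt_last.
Qed.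

Lemma desired_rate_gt0 (R : realType) (M : bottleneck R) : 0 < desired_rate M.
Proof.
by rewrite divr_gt0 ?total_mass_gt0// subr_gt0 desired_first_lt_last.
Qed.

Definition crossing_upto (R : realType) (X : outcome R) (u : R) : set R :=
  [set t | 0 < crossing_rate X t /\ crosser X t <= u].

(** No measurability is assumed of [crosser]. The order of crossings supplies it: the set is the
    intersection of the support of the rate with a down-closed set, hence with an interval. *)
Lemma measurable_crossing_upto (R : realType) (M : bottleneck R)
    (X : outcome R) (u : R) :
  feasible M X -> measurable (crossing_upto X u).
Proof.
move=> fX.
pose I : set R := [set t | exists s,
  [/\ t <= s, 0 < crossing_rate X s & crosser X s <= u]].
have -> : crossing_upto X u = [set t | 0 < crossing_rate X t] `&` I.
  apply/seteqP; split=> t [rt H]; split=> //; first by exists t.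
  have [s [ts rs su]] := H.
  by apply: le_trans su; exact: (feasible_order fX).
apply: measurableI.
  have -> : [set t | 0 < crossing_rate X t]
      = setT `&` crossing_rate X @^-1` `]0, +oo[%classic.
    by rewrite setTI; apply/seteqP; split=> t /=; rewrite in_itv/= andbT.
  by apply: (feasible_rate_measurable fX) => //; exact: measurable_itv.
apply: is_interval_measurable => a b _ [s [bs rs su]] c /andP[_ cb].
by exists s; split => //; exact: le_trans bs.
Qed.

Lemma measurable_rate (R : realType) (M : bottleneck R) (X : outcome R)
    (D : set R) :
  feasible M X -> measurable_fun D (fun t => (crossing_rate X t)%:E).
Proof.
move=> fX; apply/measurable_EFinP.
by apply: measurable_funS (feasible_rate_measurable fX).
Qed.

Lemma crossing_rate_ge0 (R : realType) (M : bottleneck R) (X : outcome R)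
    (t : R) :
  feasible M X -> 0 <= crossing_rate X t.
Proof. by move=> fX; have /andP[] := feasible_rate fX t. Qed.

Lemma integral_rate_le (R : realType) (M : bottleneck R) (X : outcome R)
    (S : set R) :
  feasible M X -> measurable S ->
  (\int[lebesgue_measure]_(t in S) (crossing_rate X t)%:E
   <= (capacity M)%:E * lebesgue_measure S)%E.
Proof.
move=> fX mS; rewrite -integral_cst//; apply: ge0_le_integral => //.
- by move=> t _; rewrite lee_fin (crossing_rate_ge0 _ fX).
- exact: measurable_rate fX.
- by move=> t _; rewrite lee_fin; have /andP[] := feasible_rate fX t.
Qed.

Lemma measurable_density (R : realType) (M : bottleneck R) (X : outcome R)
    (D : set R) :
  feasible M X -> measurable_fun D (fun t => (car_density X t)%:E).
Proof.
move=> fX; apply/measurable_EFinP.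
by apply: measurable_funS (feasible_density_measurable fX).
Qed.

Lemma integral_density_le (R : realType) (M : bottleneck R) (X : outcome R)
    (u v : R) :
  feasible M X -> desired_first M <= u -> u <= v -> v <= desired_last M ->
  (\int[lebesgue_measure]_(t in `[u, v]) (car_density X t)%:E
   <= (desired_rate M * (v - u))%:E)%E.
Proof.
move=> fX t1u uv vt2.
have dI t : `[u, v]%classic t -> 0 <= car_density X t <= desired_rate M.
  rewrite /= in_itv/= => /andP[ut tv]; apply: (feasible_density fX).
  by rewrite (le_trans t1u)//= (le_trans tv).
have -> : (desired_rate M * (v - u))%:E
    = ((desired_rate M)%:E * lebesgue_measure `[u, v]%classic)%E.
  rewrite lebesgue_measure_itv/= lte_fin EFinM; case: ltP => // vu.
  by rewrite (_ : v - u = 0)//; lra.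
rewrite -integral_cst//; apply: ge0_le_integral => //.
- by move=> t /dI /andP[]; rewrite lee_fin.
- exact: measurable_density fX.
- by move=> t /dI /andP[]; rewrite lee_fin.
Qed.

Lemma crossing_mass_between (R : realType) (M : bottleneck R) (X : outcome R)
    (u v : R) :
  feasible M X -> desired_first M <= u -> u <= v -> v <= desired_last M ->
  (\int[lebesgue_measure]_(t in crossing_upto X v `\` crossing_upto X u)
     (crossing_rate X t)%:E
   = \int[lebesgue_measure]_(t in `]u, v]) (car_density X t)%:E)%E.
Proof.
move=> fX t1u uv vt2; have ut2 := le_trans uv vt2.
have mv := feasible_mass fX v; have mu := feasible_mass fX u.
rewrite !min_l// in mv mu.
have muP := measurable_crossing_upto u fX.
have mvP := measurable_crossing_upto v fX.
have uvE : crossing_upto X v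
    = crossing_upto X u `|` (crossing_upto X v `\` crossing_upto X u).
  rewrite setDUK// => t [rt tu]; split => //; exact: le_trans uv.
have itvE : `[desired_first M, v]%classic
    = `[desired_first M, u]%classic `|` `]u, v]%classic.
  by rewrite -itv_bndbnd_setU.
have r0 t := crossing_rate_ge0 t fX.
(* Finiteness allows cancelling the mass up to [u] between the two balances in the extended
   reals. *)
have fin : (\int[lebesgue_measure]_(t in crossing_upto X u)
    (crossing_rate X t)%:E \is a fin_num)%E.
  rewrite ge0_fin_numE ?integral_ge0//; last by move=> t _; rewrite lee_fin.
  by rewrite mu (le_lt_trans (integral_density_le fX _ t1u ut2))// ltry.
rewrite -/(crossing_upto X v) uvE itvE in mv.
rewrite ge0_integral_setU// in mv; last 4 first.
- exact: measurableD.
- exact: measurable_rate fX.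
- by move=> t _; rewrite lee_fin.
- by apply/disj_setPS => t [tu [_ /(_ tu)]].
rewrite ge0_integral_setU// in mv; last 3 first.
- exact: measurable_density fX.
- move=> t; rewrite -itvE /= in_itv/= => /andP[t1t tv]; rewrite lee_fin.
  have tI : desired_first M <= t <= desired_last M by rewrite t1t (le_trans tv).
  by have /andP[] := feasible_density fX tI.
- apply/disj_setPS => t /=; rewrite !in_itv/= => -[/andP[_ tu] /andP[ut _]].
  by move: ut; rewrite ltNge tu.
rewrite -mu -/(crossing_upto X u) in mv.
by rewrite -[LHS](addeK _ fin) -[RHS](addeK _ fin) [X in (X - _)%E]addeC mv addeC.
Qed.

(* If every user with desired time in ]a, b[ strictly prefers the car, they are
   too many to all cross within [a, b], since capacity M < desired_rate M. *)
Lemma crossing_outside (R : realType) (M : bottleneck R) (tau : R -> R)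
    (X : outcome R) (a b : R) :
  equilibrium M tau X -> capacity M < desired_rate M ->
  desired_first M <= a -> a < b -> b <= desired_last M ->
  (forall v, a < v < b -> user_cost M tau (delay X) v < transit_cost M) ->
  exists t, [/\ 0 < crossing_rate X t, a < crosser X t < b & t < a \/ b < t].
Proof.
move=> eX mulam t1a ab bt2 Cab; apply: contrapT => noX.
have fX := equilibrium_feasible eX.
have inside t : 0 < crossing_rate X t -> a < crosser X t < b -> a <= t <= b.
  move=> rt xt; rewrite !leNgt -negb_or; apply/negP => H; apply: noX.
  by exists t; split => //; exact/orP.
have l0 := desired_rate_gt0 M.
(* Chosen so that the demand in []a, u]] is midway between what [[a, b]] can serve,
   [capacity M * (b - a)], and the whole demand [desired_rate M * (b - a)]. *)
pose u := a + (b - a) * (capacity M + desired_rate M) / (2 * desired_rate M).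
have uE : desired_rate M * (u - a)
    = (b - a) * (capacity M + desired_rate M) / 2.
  by rewrite /u; field; rewrite gt_eqF.
have au : a < u.
  have : 0 < desired_rate M * (u - a).
    rewrite uE divr_gt0// mulr_gt0 ?subr_gt0// addr_gt0//.
    exact: capacity_gt0.
  by rewrite pmulr_rgt0// subr_gt0.
have ub : u < b.
  suff : desired_rate M * (u - a) < desired_rate M * (b - a).
    by rewrite ltr_pM2l// ltrD2r.
  rewrite uE ltr_pdivrMr//.
  have : 0 < (b - a) * (desired_rate M - capacity M) by rewrite mulr_gt0// subr_gt0.
  lra.
have := crossing_mass_between fX t1a (ltW au) (le_trans (ltW ub) bt2).
have -> : (\int[lebesgue_measure]_(t in `]a, u]) (car_density X t)%:E
    = (desired_rate M * (u - a))%:E)%E.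
  rewrite (_ : (_ * _)%:E = (desired_rate M)%:E
      * lebesgue_measure `]a, u]%classic)%E; last first.
    by rewrite lebesgue_measure_itv/= lte_fin au EFinM.
  rewrite -integral_cst//; apply: eq_integral => t.
  rewrite mem_setE in_itv/= => /andP[at_ tu]; congr _%:E.
  apply: (full_car_density eX); first by lra.
  by apply: Cab; rewrite at_ (le_lt_trans tu).
apply/eqP; rewrite lt_eqF//.
apply: (@le_lt_trans _ _
    (\int[lebesgue_measure]_(t in `[a, b]) (crossing_rate X t)%:E)%E).
  apply: ge0_subset_integral => //.
  - by apply: measurableD; apply: measurable_crossing_upto fX.
  - exact: measurable_rate fX.
  - by move=> t _; rewrite lee_fin (crossing_rate_ge0 _ fX).
  - move=> t [[rt xu] /not_andP[//|/negP]]; rewrite -ltNge => ax.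
    by rewrite /= in_itv/=; apply: inside; rewrite // ax (le_lt_trans xu).
apply: (le_lt_trans (integral_rate_le fX _)) => //.
rewrite lebesgue_measure_itv/= lte_fin ab -EFinM lte_fin uE.
rewrite ltr_pdivlMr//.
have : 0 < (b - a) * (desired_rate M - capacity M) by rewrite mulr_gt0// subr_gt0.
lra.
Qed.

(** * Bounds on the toll from early and late crossings *)

(** Instance of [early_slope], whose counting hypothesis is [crossing_outside]. *)
Lemma user_cost_early (R : realType) (M : bottleneck R) (tau : R -> R)
    (X : outcome R) (s v : R) :
  (forall t, 0 <= tau t) -> equilibrium M tau X ->
  capacity M < desired_rate M ->
  0 < crossing_rate X s -> s < crosser X s -> desired_first M <= v <= crosser X s ->
  user_cost M tau (delay X) (crosser X s)
  = user_cost M tau (delay X) v + earliness M * (crosser X s - v).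
Proof.
move=> tau0 eX mulam rs ss vI.
have fX := equilibrium_feasible eX; have w0 := feasible_delay fX.
have e0 := earliness_gt0 M; have L0 := lateness_gt0 M.
have Clip u u' := user_cost_lip M u u' tau0 w0.
apply: (@early_slope R (earliness M) (lateness M) (desired_first M)
  (desired_last M) (transit_cost M) (user_cost M tau (delay X))
  (fun t x => 0 < crossing_rate X t /\ x = crosser X t) _ _ _ _ _ _ _ s) => //.
- by move=> ? ? [r ->]; exact: user_cost_crosser eX r.
- by move=> ? ? [r ->]; exact: user_cost_crosser_le eX r.
- by move=> ? ? [r ->]; exact: (feasible_crosser fX r).
- move=> a b t1a ab bt2 H.
  have [r [? ? ?]] := crossing_outside eX mulam t1a ab bt2 H.
  by exists r, (crosser X r).
Qed.

(** Follow the slope of the least cost down from [crosser X s]. This slope is known only from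
    [desired_first M] on, while [t] may precede that time; in that case the descent passes through
    [crosser X t] and then uses tightness at [t]. *)
Lemma toll_le_early (R : realType) (M : bottleneck R) (tau : R -> R)
    (X : outcome R) (t s : R) :
  (forall t, 0 <= tau t) -> equilibrium M tau X ->
  capacity M < desired_rate M ->
  0 < crossing_rate X t -> 0 < crossing_rate X s -> s < crosser X s ->
  tau t <= transit_cost M - car_cost M - earliness M * (crosser X s - t).
Proof.
Proof.
move=> tau0 eX mulam rt rs ss.
have fX := equilibrium_feasible eX.
have e0 := earliness_gt0 M; have L0 := lateness_gt0 M.
have /andP[t1x xt2] := feasible_crosser fX rt.
have slope v (vI : desired_first M <= v <= crosser X s) := user_cost_early tau0 eX mulam rs ss vI.
have Zs := user_cost_crosser_le tau0 eX rs.
have Zt := user_cost_crosser_le tau0 eX rt.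
have Ct := user_cost_crosser tau0 eX rt.
have taut := toll_le_user_cost tau0 eX rt.
have [sx|xs] := leP (crosser X s) (crosser X t).
  have [ts|st] := leP t (crosser X s).
    rewrite schedule_cost_early in Ct; last exact: le_trans sx.
    have : 0 <= earliness M * (crosser X t - crosser X s).
      by rewrite mulr_ge0 ?subr_ge0// ltW.
    lra.
  have := schedule_cost_ge0 t (crosser X t) (ltW e0) (ltW L0).
  have : 0 <= earliness M * (t - crosser X s).
    by rewrite mulr_ge0 ?subr_ge0// ltW.
  lra.
have [tx|xt] := leP t (crosser X t).
  rewrite schedule_cost_early// in Ct.
  have := slope (crosser X t); rewrite t1x ltW// => /(_ isT); lra.
have [ts|st] := leP t (crosser X s).
  have := slope t; rewrite (le_trans t1x (ltW xt)) ts => /(_ isT); lra.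
have := schedule_cost_ge0 t (crosser X t) (ltW e0) (ltW L0).
have : 0 <= earliness M * (t - crosser X s).
  by rewrite mulr_ge0 ?subr_ge0// ltW.
lra.
Qed.

Lemma user_cost_late (R : realType) (M : bottleneck R) (tau : R -> R)
    (X : outcome R) (s v : R) :
  (forall t, 0 <= tau t) -> equilibrium M tau X ->
  capacity M < desired_rate M ->
  0 < crossing_rate X s -> crosser X s < s -> crosser X s <= v <= desired_last M ->
  user_cost M tau (delay X) (crosser X s)
  = user_cost M tau (delay X) v + lateness M * (v - crosser X s).
Proof.
move=> tau0 eX mulam rs ss vI.
have fX := equilibrium_feasible eX; have w0 := feasible_delay fX.
have e0 := earliness_gt0 M; have L0 := lateness_gt0 M.
have Clip u u' := user_cost_lip M u u' tau0 w0.
apply: (@late_slope R (earliness M) (lateness M) (desired_first M)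
  (desired_last M) (transit_cost M) (user_cost M tau (delay X))
  (fun t x => 0 < crossing_rate X t /\ x = crosser X t) _ _ _ _ _ _ _ s) => //.
- by move=> ? ? [r ->]; exact: user_cost_crosser eX r.
- by move=> ? ? [r ->]; exact: user_cost_crosser_le eX r.
- by move=> ? ? [r ->]; exact: (feasible_crosser fX r).
- move=> a b t1a ab bt2 H.
  have [r [? ? ?]] := crossing_outside eX mulam t1a ab bt2 H.
  by exists r, (crosser X r).
Qed.

Lemma toll_le_late (R : realType) (M : bottleneck R) (tau : R -> R)
    (X : outcome R) (t s : R) :
  (forall t, 0 <= tau t) -> equilibrium M tau X ->
  capacity M < desired_rate M ->
  0 < crossing_rate X t -> 0 < crossing_rate X s -> crosser X s < s ->
  tau t <= transit_cost M - car_cost M - lateness M * (t - crosser X s).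
Proof.
move=> tau0 eX mulam rt rs ss.
have fX := equilibrium_feasible eX.
have e0 := earliness_gt0 M; have L0 := lateness_gt0 M.
have /andP[t1x xt2] := feasible_crosser fX rt.
have slope v (vI : crosser X s <= v <= desired_last M) := user_cost_late tau0 eX mulam rs ss vI.
have Zs := user_cost_crosser_le tau0 eX rs.
have Zt := user_cost_crosser_le tau0 eX rt.
have Ct := user_cost_crosser tau0 eX rt.
have taut := toll_le_user_cost tau0 eX rt.
have [xs|sx] := leP (crosser X t) (crosser X s).
  have [st|ts] := leP (crosser X s) t.
    rewrite schedule_cost_late in Ct; last exact: le_trans st.
    have : 0 <= lateness M * (crosser X s - crosser X t).
      by rewrite mulr_ge0 ?subr_ge0// ltW.
    lra.
  have := schedule_cost_ge0 t (crosser X t) (ltW e0) (ltW L0).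
  have : 0 <= lateness M * (crosser X s - t).
    by rewrite mulr_ge0 ?subr_ge0// ltW.
  lra.
have [xt|tx] := leP (crosser X t) t.
  rewrite schedule_cost_late// in Ct.
  have := slope (crosser X t); rewrite xt2 ltW// => /(_ isT); lra.
have [st|ts] := leP (crosser X s) t.
  have := slope t; rewrite (le_trans (ltW tx) xt2) st => /(_ isT); lra.
have := schedule_cost_ge0 t (crosser X t) (ltW e0) (ltW L0).
have : 0 <= lateness M * (crosser X s - t).
  by rewrite mulr_ge0 ?subr_ge0// ltW.
lra.
Qed.

(** Otherwise the least cost would have both slopes, [earliness M] and [- lateness M], between the
    two desired times. *)
Lemma early_le_late (R : realType) (M : bottleneck R) (tau : R -> R)
    (X : outcome R) (t s : R) :
  (forall t, 0 <= tau t) -> equilibrium M tau X ->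
  capacity M < desired_rate M ->
  0 < crossing_rate X t -> 0 < crossing_rate X s ->
  t < crosser X t -> crosser X s < s -> crosser X t <= crosser X s.
Proof.
move=> tau0 eX mulam rt rs tt ss; rewrite leNgt; apply/negP => st.
have fX := equilibrium_feasible eX.
have /andP[_ t2] := feasible_crosser fX rt.
have /andP[t1 _] := feasible_crosser fX rs.
have := user_cost_early tau0 eX mulam rt tt (introT andP (conj t1 (ltW st))).
have := user_cost_late tau0 eX mulam rs ss (introT andP (conj (ltW st) t2)).
have : 0 < earliness M * (crosser X t - crosser X s).
  by rewrite mulr_gt0 ?earliness_gt0 ?subr_gt0.
have : 0 < lateness M * (crosser X t - crosser X s).
  by rewrite mulr_gt0 ?lateness_gt0 ?subr_gt0.
lra.
Qed.

(** * Masses of early and late users, and the upper bound on revenue *)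

Lemma mass_le (R : realType) (M : bottleneck R) (X : outcome R)
    (S S' : set R) :
  feasible M X -> measurable S -> measurable S' ->
  (forall t, S t -> 0 < crossing_rate X t -> S' t) ->
  (\int[lebesgue_measure]_(t in S) (crossing_rate X t)%:E
   <= \int[lebesgue_measure]_(t in S') (crossing_rate X t)%:E)%E.
Proof.
move=> fX mS mS' SS'; have r0 t := crossing_rate_ge0 t fX.
rewrite integral_mkcond [leRHS]integral_mkcond; apply: ge0_le_integral => //.
- by move=> t _; rewrite patchE; case: ifP => // _; rewrite lee_fin.
- by apply/(measurable_restrictT _ _).1 => //; exact: measurable_rate fX.
- by apply/(measurable_restrictT _ _).1 => //; exact: measurable_rate fX.
- move=> t _; rewrite !patchE; case: ifPn => [|_]; last first.
    by case: ifP => // _; rewrite lee_fin.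
  rewrite inE => St; case: ifPn => // /negP S't; rewrite lee_fin leNgt.
  by apply/negP => rt; apply: S't; rewrite inE; exact: SS'.
Qed.

Lemma mass_upto_le (R : realType) (M : bottleneck R) (X : outcome R)
    (S : set R) (u : R) :
  feasible M X -> measurable S -> desired_first M <= u <= desired_last M ->
  (forall t, S t -> 0 < crossing_rate X t -> crosser X t <= u) ->
  (\int[lebesgue_measure]_(t in S) (crossing_rate X t)%:E
   <= (desired_rate M * (u - desired_first M))%:E)%E.
Proof.
move=> fX mS /andP[t1u ut2] Su.
apply: (@le_trans _ _ (\int[lebesgue_measure]_(t in crossing_upto X u)
    (crossing_rate X t)%:E)%E).
  apply: (mass_le fX) => //; first exact: measurable_crossing_upto fX.
  by move=> t St rt; split => //; exact: Su.
by rewrite (feasible_mass fX) min_l//; exact: (integral_density_le fX).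
Qed.

Lemma mass_from_le (R : realType) (M : bottleneck R) (X : outcome R)
    (S : set R) (u : R) :
  feasible M X -> measurable S -> desired_first M <= u <= desired_last M ->
  (forall t, S t -> 0 < crossing_rate X t -> u <= crosser X t) ->
  (\int[lebesgue_measure]_(t in S) (crossing_rate X t)%:E
   <= (desired_rate M * (desired_last M - u))%:E)%E.
Proof.
move=> fX mS /andP[t1u ut2] Su; have l0 := desired_rate_gt0 M.
have [ut1|t1u'] := leP u (desired_first M).
  have -> : u = desired_first M by apply/eqP; rewrite eq_le ut1.
  apply: mass_upto_le => //; first by rewrite lexx (le_trans t1u).
  by move=> t _ /(feasible_crosser fX) /andP[].
apply/lee_addgt0Pr => d d0.
(* Differences of [crossing_upto] sets leave out their lower endpoint, so counting starts slightly
   before [u], at the price of a mass at most [d]. *)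
pose v := Num.max (desired_first M) (u - d / desired_rate M).
have t1v : desired_first M <= v by rewrite le_max lexx.
have vu : v < u by rewrite gt_max t1u' ltrBlDr ltrDl divr_gt0.
have vt2 : v <= desired_last M by rewrite (le_trans (ltW vu)).
apply: (@le_trans _ _ (\int[lebesgue_measure]_(t in
    crossing_upto X (desired_last M) `\` crossing_upto X v)
    (crossing_rate X t)%:E)%E).
  apply: (mass_le fX) => //.
    by apply: measurableD; exact: measurable_crossing_upto fX.
  move=> t St rt; split.
    by split => //; have /andP[] := feasible_crosser fX rt.
  by move=> [_]; apply/negP; rewrite -ltNge (lt_le_trans vu)// Su.
rewrite (crossing_mass_between fX)//.
apply: (@le_trans _ _ (\int[lebesgue_measure]_(t in `[v, desired_last M])
    (car_density X t)%:E)%E).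
  apply: ge0_subset_integral => //.
  - exact: measurable_density fX.
  - move=> t; rewrite /= in_itv/= => /andP[vt tt2]; rewrite lee_fin.
    have tI : desired_first M <= t <= desired_last M.
      by rewrite tt2 (le_trans t1v).
    by have /andP[] := feasible_density fX tI.
  - by move=> t; rewrite /= !in_itv/= => /andP[/ltW -> ->].
apply: (le_trans (integral_density_le fX _ _ _)) => //.
rewrite -EFinD lee_fin.
have : u - d / desired_rate M <= v by rewrite le_max lexx orbT.
rewrite lerBlDr -lerBlDl ler_pdivlMr// => H.
by rewrite -lerBlDl -mulrBr mulrC; lra.
Qed.

(* [c] is a Lagrange multiplier for the mass of the early and late users, and
   [kappa] bounds the revenue per unit of desired time. *)
Lemma toll_paid_le (R : realType) (M : bottleneck R) (tau : R -> R)
    (X : outcome R) (c kappa : R) :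
  toll_policy tau -> equilibrium M tau X -> capacity M < desired_rate M ->
  0 <= c <= transit_cost M - car_cost M ->
  desired_rate M * (transit_cost M - car_cost M - c) <= kappa ->
  capacity M * (transit_cost M - car_cost M) <= kappa ->
  toll_paid tau X <= kappa * (desired_last M - desired_first M)
    + capacity M * c ^+ 2 * ((earliness M)^-1 + (lateness M)^-1) / 2.
Proof.
move=> [mtau tau0] eX mulam /andP[c0 cD] kD kmu.
have fX := equilibrium_feasible eX.
have e0 := earliness_gt0 M; have L0 := lateness_gt0 M.
have t12 := desired_first_lt_last M.
have mu0 := capacity_gt0 M.
set D := transit_cost M - car_cost M in cD kD kmu *.
set t1 := desired_first M in t12 *; set t2 := desired_last M in t12 *.
(* The endpoints [t1] and [t2] are added so that the supremum and the infimum below make sense even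
   when nobody is early or nobody is late. *)
pose early : set R := [set x | x = t1 \/
  exists t, [/\ 0 < crossing_rate X t, t < crosser X t & x = crosser X t]].
pose late : set R := [set x | x = t2 \/
  exists t, [/\ 0 < crossing_rate X t, crosser X t < t & x = crosser X t]].
have earlyI x : early x -> t1 <= x <= t2.
  by move=> [->|[t [rt _ ->]]]; [rewrite lexx ltW|exact: (feasible_crosser fX)].
have lateI x : late x -> t1 <= x <= t2.
  by move=> [->|[t [rt _ ->]]]; [rewrite lexx ltW|exact: (feasible_crosser fX)].
have el x y : early x -> late y -> x <= y.
  move=> ex [->|[s [rs ss ->]]]; first by have /andP[] := earlyI _ ex.
  case: ex => [->|[t [rt tt ->]]].
    by have /andP[] := feasible_crosser fX rs.
  exact: (early_le_late tau0 eX).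
have early1 : early t1 by left.
have late2 : late t2 by left.
pose b := sup early; pose a := inf late.
have eb x : early x -> x <= b.
  by apply: sup_upper_bound; split; [exists t1|exists t2 => y /earlyI/andP[]].
have la x : late x -> a <= x.
  by apply: ge_inf; exists t1 => y /lateI/andP[].
have ba : b <= a.
  apply: ge_sup; first by exists t1.
  by move=> x ex; apply: lb_le_inf; [exists t2|move=> y; exact: el].
have t1b := eb _ early1; have at2 := la _ late2.
have tauD t : 0 < crossing_rate X t -> tau t <= D.
  move=> rt; have := toll_le_user_cost tau0 eX rt.
  have := user_cost_crosser tau0 eX rt.
  have := schedule_cost_ge0 t (crosser X t) (ltW e0) (ltW L0).
  have := user_cost_crosser_le tau0 eX rt; rewrite /D; lra.
have taub t : 0 < crossing_rate X t -> tau t <= D - earliness M * (b - t).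
  move=> rt; have tD := tauD _ rt.
  suff : b <= t + (D - tau t) / earliness M.
    by rewrite -lerBlDl ler_pdivlMr// [_ * earliness M]mulrC; lra.
  apply: ge_sup; first by exists t1.
  move=> x ex; rewrite -lerBlDl ler_pdivlMr// [_ * earliness M]mulrC.
  case: ex => [->|[s [rs ss ->]]]; last first.
    by have := toll_le_early tau0 eX mulam rt rs ss; rewrite /D; lra.
  (* For the added point [t1], a crossing before [t1] is itself early and can serve as its own
     reference. *)
  have [t1t|tt1] := leP t1 t.
    have : 0 <= earliness M * (t - t1) by rewrite mulr_ge0 ?subr_ge0// ltW.
    lra.
  have /andP[t1x _] := feasible_crosser fX rt.
  have tt : t < crosser X t by exact: lt_le_trans t1x.
  have := toll_le_early tau0 eX mulam rt rt tt.
  have : 0 <= earliness M * (crosser X t - t1).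
    by rewrite mulr_ge0 ?subr_ge0// ltW.
  rewrite /D; lra.
have taua t : 0 < crossing_rate X t -> tau t <= D - lateness M * (t - a).
  move=> rt; have tD := tauD _ rt.
  suff : t - (D - tau t) / lateness M <= a.
    by rewrite lerBlDr -lerBlDl ler_pdivlMr// [_ * lateness M]mulrC; lra.
  apply: lb_le_inf; first by exists t2.
  move=> x lx; rewrite lerBlDr -lerBlDl ler_pdivlMr// [_ * lateness M]mulrC.
  case: lx => [->|[s [rs ss ->]]]; last first.
    by have := toll_le_late tau0 eX mulam rt rs ss; rewrite /D; lra.
  have [tt2|t2t] := leP t t2.
    have : 0 <= lateness M * (t2 - t) by rewrite mulr_ge0 ?subr_ge0// ltW.
    lra.
  have /andP[_ xt2] := feasible_crosser fX rt.
  have tt : crosser X t < t by exact: le_lt_trans xt2 _.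
  have := toll_le_late tau0 eX mulam rt rt tt.
  have : 0 <= lateness M * (t2 - crosser X t).
    by rewrite mulr_ge0 ?subr_ge0// ltW.
  rewrite /D; lra.
have rate0 t := crossing_rate_ge0 t fX.
have mrate := feasible_rate_measurable fX.
have mf D' : measurable_fun D' (fun t => (crossing_rate X t * tau t)%:E).
  exact: measurable_mulEFin.
have f0 t : (0 <= (crossing_rate X t * tau t)%:E)%E.
  by rewrite lee_fin mulr_ge0.
have massb : (\int[lebesgue_measure]_(t in `]-oo, b[) (crossing_rate X t)%:E
    <= (desired_rate M * (b - t1))%:E)%E.
  apply: (mass_upto_le fX) => //; first by rewrite t1b (le_trans ba).
  (* A user crossing before [b] but desired after [b] would be early, hence desired at most at
     [b]. *)
  move=> t; rewrite /= in_itv/= => tb rt; rewrite leNgt; apply/negP => bx.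
  have : crosser X t <= b.
    by apply: eb; right; exists t; split => //; exact: lt_trans bx.
  by rewrite leNgt bx.
have massa : (\int[lebesgue_measure]_(t in `]a, +oo[) (crossing_rate X t)%:E
    <= (desired_rate M * (t2 - a))%:E)%E.
  apply: (mass_from_le fX) => //; first by rewrite at2 (le_trans t1b).
  move=> t; rewrite /= in_itv/= andbT => ta rt; rewrite leNgt; apply/negP => xa.
  have : a <= crosser X t.
    by apply: la; right; exists t; split => //; exact: lt_trans ta.
  by rewrite leNgt xa.
have ce : 0 <= c / earliness M by rewrite divr_ge0// ltW.
have cL : 0 <= c / lateness M by rewrite divr_ge0// ltW.
have cD' : 0 <= D - c by rewrite subr_ge0.
(* The bound [D - earliness M * (b - t)] is split as [D - c] plus an affine term worth [c] at [b]
   and zero at [b - c / earliness M]: a triangle of area [c ^+ 2 / (2 * earliness M)]. *)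
have revb : (\int[lebesgue_measure]_(t in `]-oo, b[)
    (crossing_rate X t * tau t)%:E <=
    ((D - c) * (desired_rate M * (b - t1))
     + capacity M * (c ^+ 2 * (earliness M)^-1 / 2))%:E)%E.
  apply: le_trans (@wing_revenue R (capacity M) (D - c) (earliness M)
    (c - earliness M * b) (b - c / earliness M) b `]-oo, b[%classic
    (crossing_rate X) tau _ _ _ _ _ _ _ _ _ _) _ => //.
  - exact: feasible_rate fX.
  - by rewrite lerBlDr lerDl.
  - move=> t /andP[]; rewrite lerBlDr -lerBlDl ler_pdivlMr//; lra.
  - move=> t; rewrite /= in_itv/= => tb /negP; rewrite negb_and -!ltNge.
    rewrite (ltNge b) (ltW tb) orbF ltrBrDr -ltrBrDl ltr_pdivrMr//; lra.
  - by move=> t _ /taub; lra.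
  rewrite [leRHS]EFinD leeD//.
    by rewrite [leRHS]EFinM lee_wpmul2l// lee_fin.
  rewrite lee_fin ler_wpM2l ?(ltW mu0)// le_eqVlt; apply/orP; left; apply/eqP.
  by field; rewrite gt_eqF.
have reva : (\int[lebesgue_measure]_(t in `]a, +oo[)
    (crossing_rate X t * tau t)%:E <=
    ((D - c) * (desired_rate M * (t2 - a))
     + capacity M * (c ^+ 2 * (lateness M)^-1 / 2))%:E)%E.
  apply: le_trans (@wing_revenue R (capacity M) (D - c) (- lateness M)
    (c + lateness M * a) a (a + c / lateness M) `]a, +oo[%classic
    (crossing_rate X) tau _ _ _ _ _ _ _ _ _ _) _ => //.
  - exact: feasible_rate fX.
  - by rewrite lerDl.
  - move=> t /andP[_]; rewrite -lerBlDl ler_pdivlMr//; lra.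
  - move=> t; rewrite /= in_itv/= andbT => ta /negP; rewrite negb_and -!ltNge.
    rewrite (ltNge t) (ltW ta)/= -ltrBrDl ltr_pdivrMr//; lra.
  - by move=> t _ /taua; lra.
  rewrite [leRHS]EFinD leeD//.
    by rewrite [leRHS]EFinM lee_wpmul2l// lee_fin.
  rewrite lee_fin ler_wpM2l ?(ltW mu0)// le_eqVlt; apply/orP; left; apply/eqP.
  by field; rewrite gt_eqF.
have revm : (\int[lebesgue_measure]_(t in `[b, a])
    (crossing_rate X t * tau t)%:E <= (capacity M * D * (a - b))%:E)%E.
  apply: (@le_trans _ _
      (\int[lebesgue_measure]_(t in `[b, a]) (0 * t + capacity M * D)%:E)%E).
    apply: ge0_le_integral => //.
    - exact: mf.
    - exact: measurable_affine.
    - move=> t _; rewrite lee_fin mul0r add0r.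
      have /andP[_ rmu] := feasible_rate fX t.
      have [rt|rt] := ltP 0 (crossing_rate X t).
        by rewrite ler_pM// tauD.
      have -> : crossing_rate X t = 0 by apply/eqP; rewrite eq_le rt rate0.
      by rewrite mul0r mulr_ge0 ?(ltW mu0)// (le_trans c0).
  by rewrite integral_affine// !mul0r add0r.
have rev : (\int[lebesgue_measure]_t (crossing_rate X t * tau t)%:E <=
    (kappa * (t2 - t1) + capacity M * c ^+ 2 *
      ((earliness M)^-1 + (lateness M)^-1) / 2)%:E)%E.
  have -> : [set: R] = `]-oo, b[%classic `|` (`[b, a]%classic `|` `]a, +oo[%classic).
    apply/seteqP; split=> // t _; rewrite /= !in_itv/= andbT.
    have [tb|bt] := ltP t b; first by left.
    by right; have [ta|at_] := leP t a; [left|right].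
  rewrite ge0_integral_setU//; last 3 first.
  - exact: measurableU.
  - exact: mf.
  - apply/disj_setPS => t /=; rewrite !in_itv/= andbT => -[tb [/andP[bt _]|at_]].
      by move: tb; rewrite ltNge bt.
    by move: (lt_trans tb (le_lt_trans ba at_)); rewrite ltxx.
  rewrite ge0_integral_setU//; last 2 first.
  - exact: mf.
  - apply/disj_setPS => t /=; rewrite !in_itv/= andbT => -[/andP[_ ta] at_].
    by move: at_; rewrite ltNge ta.
  apply: le_trans (leeD revb (leeD revm reva)) _.
  (* The lengths [b - t1], [a - b] and [t2 - a] add up to the desired interval, and each earns at
     most [kappa] per unit of length. *)
  rewrite -!EFinD lee_fin.
  have : (a - b) * (capacity M * D) <= (a - b) * kappa.
    by rewrite ler_wpM2l// subr_ge0.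
  have : (b - t1) * (desired_rate M * (D - c)) <= (b - t1) * kappa.
    by rewrite ler_wpM2l// subr_ge0.
  have : (t2 - a) * (desired_rate M * (D - c)) <= (t2 - a) * kappa.
    by rewrite ler_wpM2l// subr_ge0.
  lra.
rewrite /toll_paid /Rintegral -lee_fin fineK// ge0_fin_numE.
  by apply: le_lt_trans rev _; rewrite ltry.
by apply: integral_ge0 => t _; exact: f0.
Qed.

(** * An explicit equilibrium under a static toll *)

(* Equilibrium under the static toll [D - d], where [D] is the transit cost minus
   the car cost: the queuing delay rises at slope [earliness], stays equal to [d]
   on the plateau, where users cross on time and only [capacity] of
   [desired_rate] take the car, then falls at slope [lateness]. *)
Definition plateau_first (R : realType) (M : bottleneck R) (d : R) : R :=
  desired_first M + capacity M / desired_rate M * (d / earliness M).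

Definition plateau_last (R : realType) (M : bottleneck R) (d : R) : R :=
  desired_last M - capacity M / desired_rate M * (d / lateness M).

(** Building up the delay [d] takes [d / earliness M]. The point [plateau_first] is placed so that
    the cars crossing meanwhile at capacity are as many as all the users desired before it. *)
Definition rush_first (R : realType) (M : bottleneck R) (d : R) : R :=
  plateau_first M d - d / earliness M.

Definition rush_last (R : realType) (M : bottleneck R) (d : R) : R :=
  plateau_last M d + d / lateness M.

Definition rush_rate (R : realType) (M : bottleneck R) (d t : R) : R :=
  capacity M * \1_(`[rush_first M d, rush_last M d]%classic) t.

(** Off the plateau everybody drives, so desired times advance at rate [rho] per unit of crossing
    time. *)
Definition rush_crosser (R : realType) (M : bottleneck R) (d t : R) : R :=
  let rho := capacity M / desired_rate M in
  if t < plateau_first M d then plateau_first M d - rho * (plateau_first M d - t)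
  else if t <= plateau_last M d then t
  else plateau_last M d + rho * (t - plateau_last M d).

Definition rush_density (R : realType) (M : bottleneck R) (d v : R) : R :=
  desired_rate M - (desired_rate M - capacity M)
    * \1_(`[plateau_first M d, plateau_last M d]%classic) v.

(** Candidate for the least trip cost net of the car cost and toll; its positive part is the queuing
    delay. *)
Definition rush_cost (R : realType) (M : bottleneck R) (d v : R) : R :=
  Num.min d (Num.min (earliness M * (v - rush_first M d))
                     (lateness M * (rush_last M d - v))).

Definition rush_outcome (R : realType) (M : bottleneck R) (d : R) : outcome R :=
  Outcome (rush_rate M d) (rush_crosser M d) (rush_density M d)
    (fun t => Num.max 0 (rush_cost M d t)).

Lemma rush_rateE (R : realType) (M : bottleneck R) (d t : R) :
  rush_rate M d t
  = if rush_first M d <= t <= rush_last M d then capacity M else 0.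
Proof.
rewrite /rush_rate indicE mem_setE in_itv/=; case: ifP => _.
  by rewrite mulr1.
by rewrite mulr0.
Qed.

Lemma rush_rate_gt0 (R : realType) (M : bottleneck R) (d t : R) :
  0 < rush_rate M d t -> rush_first M d <= t <= rush_last M d.
Proof. by rewrite rush_rateE; case: ifP => //; rewrite ltxx. Qed.

Lemma rush_densityE (R : realType) (M : bottleneck R) (d v : R) :
  rush_density M d v = if plateau_first M d <= v <= plateau_last M d
                       then capacity M else desired_rate M.
Proof.
rewrite /rush_density indicE mem_setE in_itv/=; case: ifP => _.
  by rewrite mulr1; lra.
by rewrite mulr0 subr0.
Qed.

(** A minimum of affine functions of slopes [0], [earliness M] and [- lateness M], each of which
    satisfies the inequality. *)
Lemma rush_cost_lip (R : realType) (M : bottleneck R) (d s v : R) :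
  rush_cost M d v
  <= rush_cost M d s + schedule_cost (earliness M) (lateness M) s v.
Proof.
have e0 := earliness_gt0 M; have L0 := lateness_gt0 M.
have S0 := schedule_cost_ge0 s v (ltW e0) (ltW L0).
rewrite -lerBlDr /rush_cost !le_min.
set d1 := earliness M * (v - _); set d2 := lateness M * (_ - v).
have m0 : Num.min d (Num.min d1 d2) <= d by rewrite ge_min lexx.
have m1 : Num.min d (Num.min d1 d2) <= d1 by rewrite !ge_min lexx orbT.
have m2 : Num.min d (Num.min d1 d2) <= d2 by rewrite !ge_min lexx !orbT.
apply/and3P; split.
- by rewrite lerBlDr (le_trans m0)// lerDl.
- apply: (@le_trans _ _ (d1 - schedule_cost (earliness M) (lateness M) s v)).
    by rewrite lerD2r.
  have [sv|vs] := leP s v; rewrite /d1.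
    by rewrite schedule_cost_early//; lra.
  have : 0 <= earliness M * (s - v) by rewrite mulr_ge0 ?subr_ge0// ltW.
  lra.
- apply: (@le_trans _ _ (d2 - schedule_cost (earliness M) (lateness M) s v)).
    by rewrite lerD2r.
  have [sv|vs] := leP s v; rewrite /d2.
    have : 0 <= lateness M * (v - s) by rewrite mulr_ge0 ?subr_ge0// ltW.
    lra.
  by rewrite schedule_cost_late ?(ltW vs)//; lra.
Qed.

(** The mass condition says that the users of the two wings do not exceed the population; in case of
    equality the plateau is a single point. *)
Lemma plateauP (R : realType) (M : bottleneck R) (d : R) :
  0 <= d -> capacity M * d * ((earliness M)^-1 + (lateness M)^-1)
              <= total_mass M ->
  [/\ desired_first M <= plateau_first M d,
      plateau_first M d <= plateau_last M d
    & plateau_last M d <= desired_last M].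
Proof.
move=> d0 dLam.
have l0 := desired_rate_gt0 M; have mu0 := capacity_gt0 M.
have e0 := earliness_gt0 M; have L0 := lateness_gt0 M.
have rho0 : 0 <= capacity M / desired_rate M by rewrite divr_ge0// ltW.
split.
- by rewrite /plateau_first lerDl mulr_ge0// divr_ge0// ltW.
- rewrite /plateau_first /plateau_last lerBrDr -addrA -lerBrDl -mulrDr.
  rewrite mulrAC ler_pdivrMr// [leRHS]mulrC desired_rateM.
  by rewrite -mulrDr mulrA.
- by rewrite /plateau_last gerDl oppr_le0 mulr_ge0// divr_ge0// ltW.
Qed.

(** Delay and penalty add up along the same line: in the early wing both have slope [earliness M],
    so their sum is the cost line at the desired time. Together with [rush_cost_lip] this makes [t]
    an optimal crossing time. *)
Lemma rush_cost_le (R : realType) (M : bottleneck R) (d t : R) :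
  0 <= d -> capacity M < desired_rate M ->
  capacity M * d * ((earliness M)^-1 + (lateness M)^-1) <= total_mass M ->
  rush_first M d <= t <= rush_last M d ->
  Num.max 0 (rush_cost M d t)
    + schedule_cost (earliness M) (lateness M) t (rush_crosser M d t)
  <= rush_cost M d (rush_crosser M d t).
Proof.
move=> d0 mulam dLam.
have [t1B BC Ct2] := plateauP d0 dLam.
have l0 := desired_rate_gt0 M; have mu0 := capacity_gt0 M.
have e0 := earliness_gt0 M; have L0 := lateness_gt0 M.
rewrite /rush_crosser /rush_cost /rush_first /rush_last.
set B := plateau_first M d in t1B BC *; set C := plateau_last M d in BC Ct2 *.
set rho := capacity M / desired_rate M.
have rho0 : 0 <= rho by rewrite divr_ge0// ltW.
have rho1 : rho <= 1 by rewrite ler_pdivrMr// mul1r ltW.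
have dp : earliness M * (d / earliness M) = d by field; rewrite gt_eqF.
have dr : lateness M * (d / lateness M) = d by field; rewrite gt_eqF.
set p := d / earliness M in dp *; set r := d / lateness M in dr *.
move=> /andP[At tD].
have [tB|Bt] := ltP t B.
  set x := B - rho * (B - t).
  have tx : t <= x.
    have : 0 <= (1 - rho) * (B - t) by rewrite mulr_ge0; lra.
    by rewrite /x; lra.
  have xB : x <= B by rewrite /x gerBl mulr_ge0//; lra.
  rewrite schedule_cost_early//.
  have H1 : 0 <= earliness M * (B - x) by rewrite mulr_ge0; lra.
  have H2 : 0 <= lateness M * (C - x) by rewrite mulr_ge0; lra.
  have H3 : 0 <= earliness M * (t - (B - p)) by rewrite mulr_ge0; lra.
  apply: (@le_trans _ _ (earliness M * (x - (B - p)))); last first.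
    by rewrite !le_min lexx /=; apply/andP; split; lra.
  rewrite -lerBrDr ge_max; apply/andP; split; first by lra.
  by rewrite !ge_min; apply/orP; right; apply/orP; left; lra.
have [tC|Ct] := leP t C.
  rewrite schedule_cost_early// subrr mulr0 addr0.
  have H1 : 0 <= earliness M * (t - B) by rewrite mulr_ge0; lra.
  have H2 : 0 <= lateness M * (C - t) by rewrite mulr_ge0; lra.
  rewrite ge_max lexx andbT !le_min d0/=; apply/andP; split; lra.
set x := C + rho * (t - C).
have xt : x <= t.
  have : 0 <= (1 - rho) * (t - C) by rewrite mulr_ge0; lra.
  by rewrite /x; lra.
have Cx : C <= x by rewrite /x lerDl mulr_ge0//; lra.
rewrite schedule_cost_late//.
have H1 : 0 <= earliness M * (x - B) by rewrite mulr_ge0; lra.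
have H2 : 0 <= lateness M * (x - C) by rewrite mulr_ge0; lra.
have H3 : 0 <= lateness M * (C + r - t) by rewrite mulr_ge0; lra.
apply: (@le_trans _ _ (lateness M * (C + r - x))); last first.
  by rewrite !le_min lexx andbT; apply/andP; split; lra.
rewrite -lerBrDr ge_max; apply/andP; split; first by lra.
by rewrite !ge_min; apply/orP; right; apply/orP; right; lra.
Qed.

Lemma rush_cost_plateau (R : realType) (M : bottleneck R) (d v : R) :
  plateau_first M d <= v <= plateau_last M d -> rush_cost M d v = d.
Proof.
move=> /andP[Bv vC]; have e0 := earliness_gt0 M; have L0 := lateness_gt0 M.
have dp : earliness M * (d / earliness M) = d by field; rewrite gt_eqF.
have dr : lateness M * (d / lateness M) = d by field; rewrite gt_eqF.
have H1 : 0 <= earliness M * (v - plateau_first M d).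
  by rewrite mulr_ge0 ?subr_ge0// ltW.
have H2 : 0 <= lateness M * (plateau_last M d - v).
  by rewrite mulr_ge0 ?subr_ge0// ltW.
rewrite /rush_cost min_l// le_min /rush_first /rush_last.
by apply/andP; split; lra.
Qed.

Lemma rush_crosser_homo (R : realType) (M : bottleneck R) (d s t : R) :
  plateau_first M d <= plateau_last M d -> s <= t ->
  rush_crosser M d s <= rush_crosser M d t.
Proof.
move=> BC st; rewrite /rush_crosser.
have l0 := desired_rate_gt0 M; have mu0 := capacity_gt0 M.
set rho := capacity M / desired_rate M.
have rho0 : 0 <= rho by rewrite divr_ge0// ltW.
have rp x y : x <= y -> 0 <= rho * (y - x).
  by move=> xy; rewrite mulr_ge0// subr_ge0.
have Hst := rp _ _ st.
have [sB|Bs] := ltP s; have [tB|Bt] := ltP t; first by lra.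
- have HsB := rp _ _ (ltW sB).
  by have [tC|Ct] := leP t; [lra|have HCt := rp _ _ (ltW Ct); lra].
- by move: (lt_le_trans tB (le_trans Bs st)); rewrite ltxx.
have [sC|Cs] := leP s; have [tC|Ct] := leP t => //.
- by have HCt := rp _ _ (ltW Ct); lra.
- by move: (lt_le_trans Cs (le_trans st tC)); rewrite ltxx.
- by lra.
Qed.

(** * Mass balance and equilibrium conditions of the rush outcome *)

Lemma integral_const_itv (R : realType) (b0 b1 : bool) (x y k : R)
    (f : R -> R) :
  x <= y -> (forall t, x <= t <= y -> t \in Interval (BSide b0 x) (BSide b1 y) ->
    f t = k) ->
  (\int[lebesgue_measure]_(t in [set` Interval (BSide b0 x) (BSide b1 y)])
     (f t)%:E = (k * (y - x))%:E)%E.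
Proof.
move=> xy fk.
transitivity (k%:E * lebesgue_measure
    [set` Interval (BSide b0 x) (BSide b1 y)])%E; last first.
  rewrite lebesgue_measure_itv/= lte_fin; case: ltP => [_|yx]; first by rewrite EFinM.
  by rewrite (_ : y - x = 0) ?mulr0 ?mule0//; apply/eqP; rewrite subr_eq0 eq_le yx.
rewrite -integral_cst; last exact: measurable_itv.
apply: eq_integral => t; rewrite mem_setE => tI; congr _%:E; apply: fk => //.
by move: tI; rewrite itv_boundlr => /andP[]; case: b0; case: b1;
  rewrite /= /Order.le/= => ? ?; apply/andP; split => //; exact: ltW.
Qed.

Lemma measurable_rush_rate (R : realType) (M : bottleneck R) (d : R) :
  measurable_fun setT (rush_rate M d).
Proof.
apply: measurable_funM; first exact: measurable_cst.
by apply: measurable_indic; exact: measurable_itv.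
Qed.

Lemma measurable_rush_density (R : realType) (M : bottleneck R) (d : R) :
  measurable_fun setT (rush_density M d).
Proof.
apply: measurable_funB; first exact: measurable_cst.
apply: measurable_funM; first exact: measurable_cst.
by apply: measurable_indic; exact: measurable_itv.
Qed.

Lemma rush_density_bounds (R : realType) (M : bottleneck R) (d v : R) :
  capacity M < desired_rate M -> 0 <= rush_density M d v <= desired_rate M.
Proof.
move=> mulam; rewrite rush_densityE.
have l0 := desired_rate_gt0 M; have mu0 := capacity_gt0 M.
by case: ifP => _; rewrite ?lexx ltW//= ltW.
Qed.

(** The crossers desired up to [u] are those crossing up to the time [phi] assigned to [u], so both
    sides equal [capacity M * (phi - rush_first M d)]. The cases follow the position of [u] relative
    to the plateau. *)
Lemma rush_mass_in (R : realType) (M : bottleneck R) (d u : R) :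
  0 <= d -> capacity M < desired_rate M ->
  capacity M * d * ((earliness M)^-1 + (lateness M)^-1) <= total_mass M ->
  desired_first M <= u <= desired_last M ->
  (\int[lebesgue_measure]_(t in [set t | 0 < rush_rate M d t /\
                                         rush_crosser M d t <= u]%R)
     (rush_rate M d t)%:E
   = \int[lebesgue_measure]_(v in `[desired_first M, u])
       (rush_density M d v)%:E)%E.
Proof.
move=> d0 mulam dLam /andP[t1u ut2].
have [t1B BC Ct2] := plateauP d0 dLam.
have l0 := desired_rate_gt0 M; have mu0 := capacity_gt0 M.
have e0 := earliness_gt0 M; have L0 := lateness_gt0 M.
(* [k] is the inverse of the slope [rho] of [rush_crosser] in the wings; it yields [phi] there. *)
pose k := desired_rate M / capacity M; pose rho := capacity M / desired_rate M.
have k0 : 0 < k by rewrite divr_gt0.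
have rho0 : 0 < rho by rewrite divr_gt0.
have krho z : k * (rho * z) = z.
  by rewrite /k /rho; field; rewrite !gt_eqF.
have rhok z : rho * (k * z) = z.
  by rewrite /k /rho; field; rewrite !gt_eqF.
have muk z : capacity M * (k * z) = desired_rate M * z.
  by rewrite /k; field; rewrite gt_eqF.
have Bt1 : plateau_first M d - desired_first M = rho * (d / earliness M).
  by rewrite /plateau_first -/rho; lra.
have t2C : desired_last M - plateau_last M d = rho * (d / lateness M).
  by rewrite /plateau_last -/rho; lra.
have At : rush_first M d = plateau_first M d - d / earliness M by [].
have Dt : rush_last M d = plateau_last M d + d / lateness M by [].
have p0 : 0 <= d / earliness M by rewrite divr_ge0// ltW.
have r0 : 0 <= d / lateness M by rewrite divr_ge0// ltW.
have mulp : desired_rate M * (plateau_first M d - desired_first M)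
    = capacity M * (d / earliness M).
  by rewrite Bt1 -muk krho.
set p := d / earliness M in p0 Bt1 At mulp; set r := d / lateness M in r0 t2C Dt.
set B := plateau_first M d in t1B BC Bt1 mulp At.
set C := plateau_last M d in BC Ct2 t2C Dt.
have md (D : set R) : measurable_fun D (fun v => (rush_density M d v)%:E).
  apply/measurable_EFinP.
  by apply: measurable_funS (measurable_rush_density M d).
have d0' v : (0 <= (rush_density M d v)%:E)%E.
  by rewrite lee_fin; have /andP[] := rush_density_bounds d v mulam.
have IB : (\int[lebesgue_measure]_(v in `[desired_first M, B[)
    (rush_density M d v)%:E)%E
    = (desired_rate M * (B - desired_first M))%:E.
  apply: integral_const_itv => // v _; rewrite in_itv/= => /andP[_ vB].
  by rewrite rush_densityE -/B leNgt vB.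
have [phi [phi1 phi2 phiI phiE]] : exists phi : R,
  [/\ rush_first M d <= phi, phi <= rush_last M d,
   (forall t, rush_first M d <= t <= rush_last M d ->
      (rush_crosser M d t <= u) = (t <= phi)) &
   (\int[lebesgue_measure]_(v in `[desired_first M, u])
      (rush_density M d v)%:E)%E
    = (capacity M * (phi - rush_first M d))%:E].
- have [uB|Bu] := ltP u B.
    have H1 : 0 <= k * (u - desired_first M).
      by rewrite mulr_ge0 ?subr_ge0// ltW.
    have H2 : 0 < k * (B - u) by rewrite mulr_gt0 ?subr_gt0.
    have H3 : k * (B - desired_first M) = p by rewrite Bt1 krho.
    exists (B - k * (B - u)); split; [lra|lra| |].
    + move=> t _; rewrite /rush_crosser -/rho -/B -/C.
      have [tB|Bt] := ltP t B.
        rewrite lerBlDr -lerBlDl -[X in X <= _](rhok) ler_pM2l//.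
        by rewrite lerBrDl -lerBrDr.
      have -> : (t <= B - k * (B - u)) = false.
        by apply/negbTE; rewrite -ltNge; lra.
      have [tC|Ct] := leP t C; apply/negbTE; rewrite -ltNge; first by lra.
      have : 0 <= rho * (t - C) by rewrite mulr_ge0 ?subr_ge0// ltW.
      lra.
    + rewrite (@integral_const_itv _ true false _ _ (desired_rate M))//.
        congr _%:E; rewrite At.
        rewrite (_ : B - _ - _ = p - k * (B - u)); last by ring.
        by rewrite [RHS]mulrBr muk -mulp; ring.
      by move=> v /andP[_ vu] _; rewrite rush_densityE -/B leNgt (le_lt_trans vu uB).
  have [uC|Cu] := leP u C.
    exists u; split; [lra|lra| |].
    + move=> t _; rewrite /rush_crosser -/rho -/B -/C.
      have [tB|Bt] := ltP t B.
        have H : 0 <= rho * (B - t) by rewrite mulr_ge0 ?subr_ge0// ltW.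
        have -> : t <= u by apply: le_trans Bu; exact: ltW.
        by apply/idP; lra.
      have [//|Ct] := leP t C.
      have H : 0 < rho * (t - C) by rewrite mulr_gt0 ?subr_gt0.
      by apply/idP/idP; lra.
    + rewrite (_ : `[desired_first M, u]%classic
        = `[desired_first M, B[%classic `|` `[B, u]%classic); last first.
        by rewrite -itv_bndbnd_setU// bnd_simp.
      rewrite ge0_integral_setU//; last 2 first.
      * exact: md.
      * apply/disj_setPS => v /=; rewrite !in_itv/= => -[/andP[_ vB] /andP[Bv _]].
        by move: vB; rewrite ltNge Bv.
      rewrite IB (@integral_const_itv _ true false _ _ (capacity M))//.
        by rewrite -EFinD; congr _%:E; rewrite At mulp; ring.
      move=> v /andP[Bv vu] _.
      by rewrite rush_densityE -/B -/C Bv (le_trans vu uC).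
  have H1 : 0 <= k * (u - C) by rewrite mulr_ge0 ?subr_ge0// ltW.
  have H2 : k * (desired_last M - C) = r by rewrite t2C krho.
  have H3 : 0 <= k * (desired_last M - u) by rewrite mulr_ge0 ?subr_ge0// ltW.
  exists (C + k * (u - C)); split; [lra|lra| |].
  + move=> t _; rewrite /rush_crosser -/rho -/B -/C.
    have [tB|Bt] := ltP t B.
      have H : 0 <= rho * (B - t) by rewrite mulr_ge0 ?subr_ge0// ltW.
      have -> : t <= C + k * (u - C) by lra.
      by apply/idP; lra.
    have [tC|Ct] := leP t C.
      have -> : t <= C + k * (u - C) by lra.
      by apply/idP; lra.
    by rewrite -lerBrDl -[X in _ <= X]rhok ler_pM2l// lerBlDl.
  + rewrite (_ : `[desired_first M, u]%classic = `[desired_first M, B[%classic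
        `|` (`[B, C]%classic `|` `]C, u]%classic)); last first.
      by rewrite -!itv_bndbnd_setU// bnd_simp; lra.
    rewrite ge0_integral_setU//; last 3 first.
    * exact: measurableU.
    * exact: md.
    * apply/disj_setPS => v /=; rewrite !in_itv/=.
      move=> [/andP[_ vB] [/andP[Bv _]|/andP[Cv _]]]; move: vB; rewrite ltNge.
        by rewrite Bv.
      by rewrite (le_trans BC)// ltW.
    rewrite ge0_integral_setU//; last 2 first.
    * exact: md.
    * apply/disj_setPS => v /=; rewrite !in_itv/= => -[/andP[_ vC] /andP[Cv _]].
      by move: Cv; rewrite ltNge vC.
    rewrite IB (@integral_const_itv _ true false _ _ (capacity M))//; last first.
      by move=> v vBC _; rewrite rush_densityE -/B -/C vBC.
    rewrite (@integral_const_itv _ false false _ _ (desired_rate M)) ?ltW//.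
      rewrite -!EFinD; congr _%:E; rewrite At.
      rewrite (_ : C + _ - _ = C - B + p + k * (u - C)); last by ring.
      by rewrite [RHS]mulrDr muk mulp; ring.
    move=> v _; rewrite in_itv/= => /andP[Cv _].
    by rewrite rush_densityE -/B -/C leNgt [v <= C]leNgt Cv andbF.
rewrite phiE (_ : [set t | _] = `[rush_first M d, phi]%classic).
  apply: integral_const_itv => // t /andP[At' tphi] _.
  by rewrite rush_rateE At' (le_trans tphi).
apply/seteqP; split=> t /=; rewrite in_itv/=.
  by move=> [/rush_rate_gt0 tI]; rewrite phiI//; have /andP[-> _] := tI.
move=> /andP[At' tphi]; have tI : rush_first M d <= t <= rush_last M d.
  by rewrite At' (le_trans tphi).
by rewrite rush_rateE tI phiI.
Qed.

Lemma rush_crosser_itv (R : realType) (M : bottleneck R) (d t : R) :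
  0 <= d -> capacity M < desired_rate M ->
  capacity M * d * ((earliness M)^-1 + (lateness M)^-1) <= total_mass M ->
  rush_first M d <= t <= rush_last M d ->
  desired_first M <= rush_crosser M d t <= desired_last M.
Proof.
move=> d0 mulam dLam.
have [t1B BC Ct2] := plateauP d0 dLam.
rewrite /rush_crosser; set rho := capacity M / desired_rate M.
have rho0 : 0 <= rho.
  by rewrite divr_ge0// ltW ?capacity_gt0 ?desired_rate_gt0.
have BE : plateau_first M d = desired_first M + rho * (d / earliness M) by [].
have CE : plateau_last M d = desired_last M - rho * (d / lateness M) by [].
rewrite /rush_first /rush_last => /andP[At tD].
have [tB|Bt] := ltP t (plateau_first M d).
  have Bp : plateau_first M d - t <= d / earliness M by lra.
  have := ler_wpM2l rho0 Bp.
  have : 0 <= rho * (plateau_first M d - t).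
    by rewrite mulr_ge0 ?subr_ge0// ltW.
  by move=> H1 H2; apply/andP; split; lra.
have [tC|Ct] := leP t (plateau_last M d).
  by apply/andP; split; lra.
have Cr : t - plateau_last M d <= d / lateness M by lra.
have := ler_wpM2l rho0 Cr.
have : 0 <= rho * (t - plateau_last M d).
  by rewrite mulr_ge0 ?subr_ge0// ltW.
by move=> H1 H2; apply/andP; split; lra.
Qed.

Lemma rush_mass (R : realType) (M : bottleneck R) (d u : R) :
  0 <= d -> capacity M < desired_rate M ->
  capacity M * d * ((earliness M)^-1 + (lateness M)^-1) <= total_mass M ->
  (\int[lebesgue_measure]_(t in [set t | 0 < rush_rate M d t /\
                                         rush_crosser M d t <= u]%R)
     (rush_rate M d t)%:E
   = \int[lebesgue_measure]_(v in `[desired_first M,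
                                    Num.min u (desired_last M)])
       (rush_density M d v)%:E)%E.
Proof.
move=> d0 mulam dLam; have t12 := desired_first_lt_last M.
have xI t : 0 < rush_rate M d t ->
    desired_first M <= rush_crosser M d t <= desired_last M.
  by move=> /rush_rate_gt0; exact: rush_crosser_itv.
have [ut1|t1u] := ltP u (desired_first M).
  rewrite min_l; last by rewrite ltW// (lt_trans ut1).
  rewrite set_itv_ge; last by rewrite bnd_simp -ltNge.
  rewrite (_ : [set t | _] = set0) ?integral_set0//.
  apply/seteqP; split=> // t [/xI /andP[t1x _] xu].
  by move: (le_lt_trans (le_trans t1x xu) ut1); rewrite ltxx.
have [ut2|t2u] := leP u (desired_last M).
  by apply: rush_mass_in => //; rewrite t1u.
rewrite -rush_mass_in//; last by rewrite lexx ltW.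
congr (integral _ _ _); apply/seteqP; split=> t [rt xu]; split=> //.
  by have /andP[] := xI _ rt.
exact: le_trans (ltW t2u).
Qed.

Lemma rush_feasible (R : realType) (M : bottleneck R) (d : R) :
  0 <= d -> capacity M < desired_rate M ->
  capacity M * d * ((earliness M)^-1 + (lateness M)^-1) <= total_mass M ->
  feasible M (rush_outcome M d).
Proof.
move=> d0 mulam dLam; have mu0 := capacity_gt0 M.
have [t1B BC Ct2] := plateauP d0 dLam.
split=> /=.
- exact: measurable_rush_rate.
- by move=> t; rewrite rush_rateE; case: ifP => _; rewrite lexx// ltW.
- exact: measurable_rush_density.
- by move=> v _; exact: rush_density_bounds.
- by move=> t /rush_rate_gt0; exact: rush_crosser_itv.
- by move=> u; exact: rush_mass.
- by move=> s t _ _; exact: rush_crosser_homo.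
- by move=> t; rewrite le_max lexx.
(* A positive delay makes both affine terms of [rush_cost] positive, which places [t] inside the
   rush. *)
- move=> t; rewrite lt_max ltxx/= /rush_cost !lt_min.
  rewrite !pmulr_rgt0 ?earliness_gt0 ?lateness_gt0// !subr_gt0.
  by rewrite rush_rateE => /and3P[_ /ltW -> /ltW ->].
(* The delay grows at slope at most [earliness M < 1], so joining times do not go backwards. *)
- move=> s t st.
  suff H : Num.max 0 (rush_cost M d t) <= Num.max 0 (rush_cost M d s) + (t - s).
    by lra.
  rewrite ge_max; apply/andP; split.
    by rewrite addr_ge0 ?subr_ge0// le_max lexx.
  apply: le_trans (rush_cost_lip M d s t) _.
  rewrite schedule_cost_early// lerD//; last first.
    by rewrite ler_piMl ?subr_ge0// ltW// earliness_lt1.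
  by rewrite le_max lexx orbT.
Qed.

(** [rush_cost] acts as a dual certificate: it bounds every trip cost from below, is reached by the
    crossers, never exceeds [d], and equals [d] on the plateau, where the transit users are. *)
Lemma rush_equilibrium (R : realType) (M : bottleneck R) (d : R) :
  0 <= d -> capacity M < desired_rate M ->
  capacity M * d * ((earliness M)^-1 + (lateness M)^-1) <= total_mass M ->
  equilibrium M (fun=> transit_cost M - car_cost M - d) (rush_outcome M d).
Proof.
move=> d0 mulam dLam.
have lip s v : rush_cost M d v <= Num.max 0 (rush_cost M d s)
    + schedule_cost (earliness M) (lateness M) s v.
  by apply: le_trans (rush_cost_lip M d s v) _; rewrite lerD2r le_max lexx orbT.
split=> /=; first exact: rush_feasible.
- move=> t /rush_rate_gt0 tI s; rewrite !trip_costE.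
  by have := rush_cost_le d0 mulam dLam tI; have := lip s (rush_crosser M d t); lra.
- move=> t /rush_rate_gt0 tI; rewrite trip_costE.
  have := rush_cost_le d0 mulam dLam tI.
  have : rush_cost M d (rush_crosser M d t) <= d by rewrite ge_min lexx.
  lra.
- move=> v vI; rewrite rush_densityE; case: ifPn; last by rewrite ltxx.
  move=> /rush_cost_plateau Wv _ s; rewrite trip_costE.
  by have := lip s v; rewrite Wv; lra.
Qed.

Lemma rush_toll_paid (R : realType) (M : bottleneck R) (d k : R) :
  0 <= d -> capacity M * d * ((earliness M)^-1 + (lateness M)^-1)
              <= total_mass M ->
  toll_paid (fun=> k) (rush_outcome M d)
  = k * capacity M * (desired_last M - desired_first M
      + (1 - capacity M / desired_rate M) * d
        * ((earliness M)^-1 + (lateness M)^-1)).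
Proof.
move=> d0 dLam; have [t1B BC Ct2] := plateauP d0 dLam.
have p0 : 0 <= d / earliness M by rewrite divr_ge0// ltW// earliness_gt0.
have r0 : 0 <= d / lateness M by rewrite divr_ge0// ltW// lateness_gt0.
have AD : rush_first M d <= rush_last M d.
  by rewrite /rush_first /rush_last; lra.
rewrite /toll_paid /Rintegral /=.
transitivity (fine (\int[lebesgue_measure]_(t in
    `[rush_first M d, rush_last M d]) (k * capacity M)%:E)%E).
  rewrite [in RHS]integral_mkcond; congr fine; apply: eq_integral => t _.
  rewrite patchE mem_setE in_itv/= rush_rateE; case: ifP => _.
    by rewrite mulrC.
  by rewrite mul0r.
rewrite (@integral_const_itv _ true false _ _ (k * capacity M))//=.
by rewrite /rush_first /rush_last /plateau_first /plateau_last; ring.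
Qed.

(** * Revenue bounds and comparison of the two optima *)

Lemma toll_policy_cst (R : realType) (k : R) : 0 <= k -> toll_policy (fun=> k).
Proof. by move=> k0; split => //; exact: measurable_cst. Qed.

Lemma revenue_le (R : realType) (M : bottleneck R) (tau : R -> R) (c kappa : R) :
  toll_policy tau -> capacity M < desired_rate M ->
  0 <= c <= transit_cost M - car_cost M ->
  desired_rate M * (transit_cost M - car_cost M - c) <= kappa ->
  capacity M * (transit_cost M - car_cost M) <= kappa ->
  revenue M tau <= kappa * (desired_last M - desired_first M)
    + capacity M * c ^+ 2 * ((earliness M)^-1 + (lateness M)^-1) / 2.
Proof.
move=> tauP mulam cD k1 k2; rewrite /revenue.
set S := [set toll_paid tau X | X in _].
(* Without equilibrium the revenue is [sup set0 = 0], and the bound is nonnegative. *)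
have [->|/set0P S0] := eqVneq S set0.
  rewrite sup0; have /andP[c0 cD'] := cD.
  have mu0 := capacity_gt0 M; have t12 := desired_first_lt_last M.
  have K0 : 0 <= (earliness M)^-1 + (lateness M)^-1.
    by rewrite addr_ge0// invr_ge0 ltW ?earliness_gt0 ?lateness_gt0.
  have kappa0 : 0 <= kappa.
    by apply: le_trans k2; rewrite mulr_ge0 ?(ltW mu0)// (le_trans c0).
  rewrite addr_ge0//; first by rewrite mulr_ge0 ?subr_ge0 ?(ltW t12).
  by rewrite divr_ge0// !mulr_ge0 ?sqr_ge0 ?(ltW mu0).
by apply: ge_sup => // _ [X eX <-]; exact: toll_paid_le.
Qed.

Lemma static_revenue_ge (R : realType) (M : bottleneck R) (d : R) :
  capacity M < desired_rate M -> 0 <= d <= transit_cost M - car_cost M ->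
  capacity M * d * ((earliness M)^-1 + (lateness M)^-1) <= total_mass M ->
  (transit_cost M - car_cost M - d) * capacity M
    * (desired_last M - desired_first M
       + (1 - capacity M / desired_rate M) * d
         * ((earliness M)^-1 + (lateness M)^-1))
  <= revenue M (fun=> transit_cost M - car_cost M - d).
Proof.
move=> mulam /andP[d0 dD] dLam; rewrite -rush_toll_paid//.
have D0 := le_trans d0 dD.
apply: sup_upper_bound; last first.
  by exists (rush_outcome M d) => //; exact: rush_equilibrium.
split.
  exists (toll_paid (fun=> transit_cost M - car_cost M - d) (rush_outcome M d)).
  by exists (rush_outcome M d) => //; exact: rush_equilibrium.
(* The supremum dominates the exhibited equilibrium only if the set is bounded; multiplier [0] gives
   a crude bound. *)
pose kappa := desired_rate M * (transit_cost M - car_cost M).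
exists (kappa * (desired_last M - desired_first M)
  + capacity M * 0 ^+ 2 * ((earliness M)^-1 + (lateness M)^-1) / 2).
move=> _ [X eX <-]; apply: toll_paid_le => //.
- by apply: toll_policy_cst; rewrite subr_ge0.
- by rewrite lexx.
- by rewrite subr0.
- by rewrite ler_wpM2r// ltW.
Qed.


Theorem theorem2 (R : realType) (M : bottleneck R)
    (hz : car_cost M < transit_cost M)
    (hmu : capacity M < desired_rate M)
    (taus : R) (taud : R -> R)
    (hs : static_optimal M taus) (hd : dynamic_optimal M taud) :
  let Lambda := total_mass M in
  let lambda := desired_rate M in
  let mu := capacity M in
  let e := earliness M in
  let L := lateness M in
  let D := transit_cost M - car_cost M in
  let s := Lambda * e * L / (D * (lambda - mu) * (e + L)) in
  let lo := Lambda * e * L / ((lambda - mu) * (e + L)) in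
  let hi := Lambda * e * L / (e + L) * (1 / (lambda - mu) + 2 / mu) in
  let ratio := revenue M (fun=> taus) / revenue M taud in
  [/\ 0 <= s,
      0 <= D < lo -> 2 / (3 - mu / lambda) <= ratio,
      lo <= D <= hi ->
        Num.min ((2 + s) / 4) (1 / (2 * (1 - mu / lambda))) <= ratio
    & hi < D -> 2 / 3 <= ratio].
Proof.
move=> Lambda lambda mu e L D s lo hi ratio.
have D0 : 0 < D by rewrite subr_gt0.
have mu0 : 0 < mu := capacity_gt0 M.
have lam0 : 0 < lambda := desired_rate_gt0 M.
have e0 : 0 < e := earliness_gt0 M.
have L0 : 0 < L := lateness_gt0 M.
have lm0 : 0 < lambda - mu by rewrite subr_gt0.
have Lam0 : 0 < Lambda := total_mass_gt0 M.
have LamE : lambda * (desired_last M - desired_first M) = Lambda.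
  exact: desired_rateM.
have T0 : 0 < desired_last M - desired_first M.
  by rewrite subr_gt0 desired_first_lt_last.
set T := desired_last M - desired_first M in LamE T0.
pose K := e^-1 + L^-1.
have K0 : 0 < K by rewrite addr_gt0 ?invr_gt0.
have KE : K = (e + L) / (e * L) by rewrite /K; field; rewrite !gt_eqF.
pose rho := mu / lambda; pose q := 1 - rho.
have rhoE : lambda * rho = mu by rewrite /rho; field; rewrite gt_eqF.
have rho0 : 0 < rho by rewrite divr_gt0.
have qE : lambda * q = lambda - mu by rewrite /q mulrBr rhoE mulr1.
have q0 : 0 < q by rewrite -(pmulr_rgt0 _ lam0) qE.
have loE : q * K * lo = T.
  rewrite KE /lo -LamE -qE; field.
  by rewrite !gt_eqF// addr_gt0.
(* The plateau delay at which the plateau shrinks to a point and all users drive: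
   [mu * c * K = Lambda]. *)
pose c := T / (rho * K).
have cE : rho * K * c = T.
  by rewrite /c mulrC mulfVK// mulf_neq0 ?gt_eqF.
have c0 : 0 < c by rewrite divr_gt0// mulr_gt0.
have muc : mu * c * K = Lambda by rewrite -rhoE -LamE -cE; ring.
have hiE : hi = lo + 2 * c.
  rewrite /hi /lo /c KE /rho -LamE; field.
  by rewrite !gt_eqF// addr_gt0.
have sE : lo = s * D.
  rewrite /lo /s; field.
  by rewrite !gt_eqF// addr_gt0.
have s0 : 0 <= s.
  by rewrite /s ltW// divr_gt0 ?mulr_gt0// addr_gt0.
have lo0 : 0 < lo.
  by rewrite /lo divr_gt0 ?mulr_gt0// addr_gt0.
have static d : 0 <= d <= D -> d <= c ->
    (D - d) * mu * (T + q * d * K) <= revenue M (fun=> taus).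
  move=> dI dc; have /andP[d0 dD] := dI.
  apply: le_trans (hs.2 (D - d) _); last by rewrite subr_ge0.
  apply: static_revenue_ge => //.
  by rewrite -/mu -/Lambda -muc ler_wpM2r ?(ltW K0)// ler_wpM2l// ltW.
(* The constant toll [D] is itself a dynamic policy and earns a positive revenue, so dividing by the
   dynamic optimum is legitimate. *)
have taud_gt0 : 0 < revenue M taud.
  apply: (@lt_le_trans _ _ (revenue M (fun=> D - 0))); last first.
    by apply: hd.2; apply: toll_policy_cst; rewrite subr0 ltW.
  apply: lt_le_trans (static_revenue_ge _ _ _) => //.
  - rewrite !subr0 mulr0 mul0r addr0 !mulr_gt0//.
  - by rewrite lexx ltW.
  - by rewrite mulr0 mul0r ltW.
have ratio_ge r B : 0 <= r -> revenue M taud <= B ->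
    r * B <= revenue M (fun=> taus) -> r <= ratio.
  move=> r0 HB H; rewrite ler_pdivlMr//; apply: le_trans H.
  by rewrite ler_wpM2l.
have q1 : q <= 1 by rewrite /q gerBl ltW.
(* The multiplier [q * D] equalizes the two constraints on [kappa]:
   [lambda * (D - q * D) = mu * D]. *)
have dynamic : revenue M taud <= mu * D * T + mu * (q * D) ^+ 2 * K / 2.
  apply: revenue_le => //; first exact: hd.1.
  - by rewrite mulr_ge0 ?(ltW q0) ?(ltW D0)//= ler_piMl// ltW.
  - rewrite -/D -/lambda -rhoE le_eqVlt; apply/orP; left; apply/eqP.
    by rewrite /q; ring.
have congested : c <= q * D ->
    revenue M taud <= lambda * (D - c) * T + mu * c ^+ 2 * K / 2.
  move=> cqD; apply: revenue_le => //; first exact: hd.1.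
    by rewrite (ltW c0)/= (le_trans cqD)// ler_piMl// ltW.
  change (mu * D <= lambda * (D - c)); rewrite -rhoE -mulrA ler_wpM2l ?(ltW lam0)//.
  by rewrite lerBrDr -lerBrDl (le_trans cqD)// /q mulrBl mul1r.
have qD : q = 1 - rho by [].
rewrite -/rho -qD; clearbody c q rho K lo hi s ratio.
split => //.
- move=> /andP[_ Dlo]; apply: ratio_ge dynamic _.
    by rewrite divr_ge0//; lra.
  have rho3 : 0 < 3 - rho by lra.
  apply: le_trans (static 0 _ _); [|by rewrite lexx ltW|exact: ltW].
  rewrite mulrAC ler_pdivrMr// subr0 mulr0 mul0r addr0.
  (* With static toll [D], the claim reduces to [q * K * D <= T], that is [D <= lo]. *)
  have : 0 <= mu * D * q * (T - q * K * D).
    rewrite !mulr_ge0 ?subr_ge0// ?ltW//.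
    by rewrite -loE ltr_pM2l// mulr_gt0.
  by rewrite qD; lra.
- move=> /andP[loD]; rewrite hiE => Dhi; apply: ratio_ge dynamic _.
    rewrite le_min; apply/andP; split; rewrite divr_ge0//; first by lra.
    by rewrite mulr_ge0// ltW.
  (* Since [T = q * K * lo], the static bound is proportional to [(D - d) * (lo + d)], maximal at
     this [d]; [D <= hi] ensures [d <= c]. *)
  apply: le_trans (static ((D - lo) / 2) _ _); last 2 first.
  + by apply/andP; split; lra.
  + by lra.
  have -> : mu * D * T + mu * (q * D) ^+ 2 * K / 2
      = mu * q * K * D ^+ 2 * (s + q / 2).
    by rewrite -loE sE; field.
  have -> : (D - (D - lo) / 2) * mu * (T + q * ((D - lo) / 2) * K)
      = mu * q * K * D ^+ 2 * ((1 + s) ^+ 2 / 4).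
    by rewrite -loE sE; field.
  have P0 : 0 <= mu * q * K * D ^+ 2 by rewrite ltW// !mulr_gt0// exprn_gt0.
  rewrite mulrCA (ler_wpM2l P0)//.
  have sq0 : 0 < s + q / 2 by lra.
  (* This test decides which term of the minimum is the smaller one. *)
  have [sq|sq] := leP (q * (2 + s)) 2.
    apply: (@le_trans _ _ ((2 + s) / 4 * (s + q / 2))).
      by rewrite ler_wpM2r ?(ltW sq0)// ge_min lexx.
    by lra.
  apply: (@le_trans _ _ (1 / (2 * q) * (s + q / 2))).
    by rewrite ler_wpM2r ?(ltW sq0)// ge_min lexx orbT.
  have -> : 1 / (2 * q) * (s + q / 2) = s / (2 * q) + 1 / 4.
    by field; rewrite gt_eqF.
  suff : s / (2 * q) <= s * ((2 + s) / 4) by lra.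
  rewrite ler_wpM2l// -[(2 * q)^-1]mul1r ler_pdivrMr ?mulr_gt0//; lra.
- rewrite hiE => hiD.
  have cqD : c <= q * D.
    (* From [rho * K * c = T = q * K * lo] and [rho + q = 1]. *)
    have -> : c = q * (lo + c).
      apply: (mulfI (lt0r_neq0 (mulr_gt0 rho0 K0))).
      rewrite cE (_ : _ * (q * _) = rho * (q * K * lo) + q * (rho * K * c)).
        by rewrite loE cE qD; ring.
      by ring.
    by rewrite ler_wpM2l ?(ltW q0)//; lra.
  apply: ratio_ge (congested cqD) _ => //.
  apply: le_trans (static c _ _) => //; last by rewrite (ltW c0)/=; lra.
  have -> : (D - c) * mu * (T + q * c * K) = (D - c) * Lambda.
    rewrite -mulrA; congr (_ * _).
    rewrite -LamE -rhoE -cE qD; ring.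
  have -> : lambda * (D - c) * T + mu * c ^+ 2 * K / 2
      = (D - c) * Lambda + c / 2 * Lambda.
    by rewrite -[in c / 2 * _]muc -LamE; ring.
  (* What remains is [c <= D - c], which [lo + 2 * c < D] implies. *)
  rewrite -mulrDl mulrA ler_wpM2r ?(ltW Lam0)//; lra.
Qed.
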